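(* Let $X$ and $Y$ be Banach spaces, let $K_1$ be a cone in $X$, let $U_1,U_2,V_1,V_2$ be bounded and relatively open subsets of $K_1$ such that $0\in V_1$, $\overline{V}_j\subset U_j$ for $j=1,2$, and $\overline{U}_1\subset V_2$, and let $D$ be a non-empty closed convex subset of $Y$. Assume that $T=(T_1,T_2):(\overline{U}_2\setminus V_1)\times D\rightarrow K_1\times D$ is a compact map and that for each $j\in\{1,2\}$ there exists $h_j\in K_1\setminus\{0\}$ such that the following conditions hold, where $u=(u_1,u_2)$: (i) $T_1(u)+\mu h_j\neq u_1$ if $u_1\in\partial V_j$, $u_2\in D$ and $\mu\ge 0$; (ii) $T_1(u)\neq\lambda u_1$ if $u_1\in\partial U_j$, $u_2\in D$ and $\lambda\ge 1$. Then $T$ has at least three distinct fixed points $(u_1,u_2),(v_1,v_2),(w_1,w_2)\in K_1\times D$ with $u_1\in U_1\setminus\overline{V}_1$, $v_1\in U_2\setminus\overline{V}_2$ and $w_1\in V_2\setminus\overline{U}_1$.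
   Context: Banach spaces are real. A closed convex subset $K$ of a normed linear space $X$ is a cone if $\lambda u\in K$ for every $u\in K$ and all $\lambda\ge 0$, and $K\cap(-K)=\{0\}$. A map is compact if it is continuous and its image (the image of its whole domain) is relatively compact. Closures and boundaries of $U_j$, $V_j$ are taken with respect to the relative topology of $K_1$. *)

(* Defs.v *)
From HB Require Import structures.
From mathcomp Require Import all_boot all_order all_algebra.
From mathcomp Require Import all_classical all_reals all_analysis.
Import Order.TTheory GRing.Theory Num.Theory.
Import numFieldNormedType.Exports.

Set Implicit Arguments.
Unset Strict Implicit.
Unset Printing Implicit Defensive.

Local Open Scope classical_set_scope.
Local Open Scope ring_scope.

(* The library's [subspace K] keeps the carrier of the ambient space and makes
   every point outside [K] isolated. For [A `<=` K], openness, closure and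
   interior of [A] in [subspace K] are therefore the ones relative to [K];
   the inclusion is required explicitly in [rel_open]. *)
Definition rel_open (S : topologicalType) (K A : set S) : Prop :=
  A `<=` K /\ open (A : set (subspace K)).

Definition rel_closure (S : topologicalType) (K A : set S) : set S :=
  closure (A : set (subspace K)).

Definition rel_boundary (S : topologicalType) (K A : set S) : set S :=
  rel_closure K A `\` interior (A : set (subspace K)).

Definition is_cone (R : realType) (X : normedModType R) (K : set X) : Prop :=
  [/\ closed K,
      convex_set K,
      forall (u : X) (l : R), K u -> 0 <= l -> K (l *: u)
    & K `&` [set - u | u in K] = [set 0]].

(* A map [A -> B] is given by a total function; its values outside [A] are
   never constrained. *)
Definition compact_map (S1 S2 : topologicalType) (A : set S1) (B : set S2)
    (f : S1 -> S2) : Prop :=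
  [/\ forall x, A x -> B (f x),
      {within A, continuous f}
    & precompact (f @` A)].

Definition boundary_conditions (R : realType) (X Y : normedModType R)
    (K U V : set X) (D : set Y) (T1 : X * Y -> X) : Prop :=
  exists h : X,
    [/\ K h, h <> 0,
        forall (u : X * Y) (mu : R),
          rel_boundary K V u.1 -> D u.2 -> 0 <= mu ->
          T1 u + mu *: h <> u.1
      & forall (u : X * Y) (l : R),
          rel_boundary K U u.1 -> D u.2 -> 1 <= l ->
          T1 u <> l *: u.1].

(* Main.v *)
Require Import Defs.
From HB Require Import structures.
From mathcomp Require Import all_boot all_order all_algebra.
From mathcomp Require Import all_classical all_reals all_analysis.
From mathcomp Require Import lra ring.
Import Order.TTheory GRing.Theory Num.Theory.
Import numFieldNormedType.Exports.

Set Implicit Arguments.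
Unset Strict Implicit.
Unset Printing Implicit Defensive.

(** Each fixed point lies in a relative ring of the cone bounded by an inner and
    an outer relative boundary, and Schauder's theorem replaces the fixed point
    index. If [T] had no fixed point in the ring, Urysohn functions would join
    it, inside the ring and without creating fixed points there, to the map [0]
    on the side where (ii) holds and to a large multiple of [h] on the side
    where (i) holds, both extended by constants to the whole cone; the second
    component is joined to a constant of [D], which is harmless since (i) and
    (ii) do not involve it. When (ii) holds on the outer boundary (compression),
    the resulting compact self-map of the cone times [D] has no fixed point at
    all, contradicting Schauder. When (ii) holds on the inner boundary
    (expansion), its first component [n] is first made nonzero by adding a small
    multiple of [h] where it is small, and then rescaled to [(|x| / |n|) ^ 2 n]:
    this has the same fixed points away from [0] and infinity, but is
    compressive, so Schauder applies again.

    Schauder's theorem is reduced to Brouwer's on a simplex, which is proved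
    with the Petri-Voorneveld lemma on dominant sets of finitely many linear
    orders, a door-and-room parity argument needing no triangulation. *)

(** * Dominant sets and colourings *)

Section Dominance.
Import fintype boot.finset.
(* The linear orders on [T] are given by their rank functions [k i]. *)
Variables (T I : finType) (k : I -> T -> nat).
Hypothesis k_inj : forall i, injective (k i).

(** For nonempty [X] this means that no point of [T] exceeds the minima of [X] in all orders of [C]
    at once. For empty [X] any nonempty [C] qualifies, which admits a door without points. *)
Definition dominant (X : {set T}) (C : {set I}) : bool :=
  [forall t, exists i in C, forall x in X, k i t <= k i x].

Definition room (r : {set T} * {set I}) : bool :=
  dominant r.1 r.2 && (#|r.1| == #|r.2|).

Definition door (d : {set T} * {set I}) : bool :=
  dominant d.1 d.2 && (#|d.1|.+1 == #|d.2|).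

Definition incident (d r : {set T} * {set I}) : bool :=
  (d.1 \subset r.1) && (r.2 \subset d.2).

Lemma dominantP (X : {set T}) (C : {set I}) :
  reflect (forall t, exists2 i, i \in C & forall x, x \in X -> k i t <= k i x)
          (dominant X C).
Proof.
apply: (iffP forallP) => dom t.
  by have /exists_inP[i iC /forall_inP iP] := dom t; exists i.
by have [i iC iP] := dom t; apply/exists_inP; exists i => //; apply/forall_inP.
Qed.

Lemma dominantS (X Y : {set T}) (C D : {set I}) :
  Y \subset X -> C \subset D -> dominant X C -> dominant Y D.
Proof.
move=> /subsetP YX /subsetP CD /dominantP dom; apply/dominantP => t.
by have [i /CD iD iX] := dom t; exists i => // x /YX; apply: iX.
Qed.

Lemma dominant_min (X : {set T}) (C : {set I}) : dominant X C ->
  forall x, x \in X -> exists2 i, i \in C & forall z, z \in X -> k i x <= k i z.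
Proof. by move=> /dominantP dom x _; apply: dom. Qed.

(* Counting shows that a room arises from an incident door by adding one
   element to the first component or removing one from the second. *)
Lemma incident_roomP (d r : {set T} * {set I}) :
  #|d.1|.+1 = #|d.2| -> #|r.1| = #|r.2| -> incident d r ->
  (exists2 i, i \in d.2 & r = (d.1, d.2 :\ i)) \/
  (exists2 y, y \notin d.1 & r = (y |: d.1, d.2)).
Proof.
case: d r => [t D] [s C] /= cd cr /andP[/= ts CD].
have := subset_leq_card ts; have := subset_leq_card CD => leC leS.
have : (#|s| == #|t|) || (#|C| == #|D|).
  by rewrite -cr -cd; move: leC leS; rewrite -cr -cd leq_eqVlt => /orP[->|];
    rewrite ?orbT // ltnS => st ts'; rewrite eqn_leq st ts'.
case/orP => /eqP ceq.
- have -> : s = t by apply/eqP; rewrite eq_sym eqEcard ts ceq leqnn.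
  left; have /properP[_ [i iD iC]] : C \proper D.
    by rewrite properEcard CD -cr ceq -cd ltnSn.
  exists i => //; congr (_, _); apply/eqP.
  rewrite eqEcard subsetD1 CD iC /= -cr ceq.
  by rewrite (cardsD1 i D) iD add1n in cd; case: cd => ->.
- have -> : C = D by apply/eqP; rewrite eqEcard CD ceq leqnn.
  right; have /properP[_ [y ys yt]] : t \proper s.
    by rewrite properEcard ts cr ceq -cd ltnSn.
  exists y => //; congr (_, _); apply/esym/eqP.
  by rewrite eqEcard subUset sub1set ys ts /= cardsU1 yt add1n cr cd ceq.
Qed.

(** * The two rooms of a door that has points *)

Section InnerDoor.
Variables (t : {set T}) (D : {set I}) (x0 : T).
Hypotheses (dom : dominant t D) (cardD : #|t|.+1 = #|D|) (x0t : x0 \in t).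

Let m (i : I) : T := [arg min_(x < x0 in t) k i x].

Let m_in i : m i \in t. Proof. by rewrite /m; case: arg_minnP. Qed.

Let m_le i x : x \in t -> k i (m i) <= k i x.
Proof. by rewrite /m; case: arg_minnP => // y _; apply. Qed.

Let m_min i x : x \in t -> (forall z, z \in t -> k i x <= k i z) -> m i = x.
Proof.
by move=> xt xP; apply: (@k_inj i); apply/eqP; rewrite eqn_leq m_le //= xP.
Qed.

(* [M i]: the points that contradict the dominance of [t] w.r.t. [D :\ i]. *)
Let M (i : I) : {set T} :=
  [set y | [forall j in D :\ i, k j (m j) < k j y]].

Let MP i y :
  reflect (forall j, j \in D -> j != i -> k j (m j) < k j y) (y \in M i).
Proof.
rewrite inE; apply: (iffP forall_inP) => Mi j.
  by move=> jD ji; apply: Mi; rewrite !inE ji.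
by rewrite !inE => /andP[ji jD]; apply: Mi.
Qed.

Let dominant_rem i : dominant t (D :\ i) = (M i == set0).
Proof.
apply/idP/eqP => [/dominantP domi|M0].
  apply/setP => y; rewrite [RHS]inE; apply/negP => /MP yM.
  have [j] := domi y; rewrite !inE => /andP[ji jD] /(_ _ (m_in j)).
  by rewrite leqNgt yM.
apply/dominantP => y; have : y \notin M i by rewrite M0 inE.
rewrite inE negb_forall => /existsP[j]; rewrite negb_imply -leqNgt.
by case/andP=> jD ym; exists j => // x /(m_le j); apply: leq_trans.
Qed.

(** Dominance applied to a point of [t] itself makes that point the minimum of [t] in some order. *)
Let imset_m (E : {set I}) : dominant t E -> m @: E = t.
Proof.
move=> domE; apply/setP => x; apply/imsetP/idP => [[i _ ->]//|xt].
by have [i iE iP] := dominant_min domE xt; exists i => //;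
  rewrite (m_min xt iP).
Qed.

(* The minima of [t] for the orders in [D] exhaust [t], which has one element
   less than [D]; so exactly one pair of orders collides, and each of the two
   colliding orders leads to one room. *)
Let collision : exists i1 i2, [/\ i1 \in D, i2 \in D, i1 != i2, m i1 = m i2 &
  forall i, i \in D -> m @: (D :\ i) = t -> i \in [set i1; i2]].
Proof.
have : ~~ dinjectiveb m (mem D).
  apply/negP => /dinjectiveP /imset_injP.
  by rewrite imset_m // -cardD => /eqP /n_Sn.
case/dinjectivePn => i1 i1D [i2 /andP[i21 i2D] m12].
exists i1, i2; split => //; first by rewrite eq_sym.
move=> i iD mi; have inj : {in D :\ i &, injective m}.
  by apply/imset_injP; rewrite mi; have := cardsD1 i D;
    rewrite iD -cardD => -[->].
rewrite !inE; apply/negPn; rewrite negb_or; apply/negP => /andP[ii1 ii2].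
by have := inj i1 i2; rewrite !inE !(eq_sym _ i) ii1 ii2 i1D i2D => /(_ isT isT
  m12)
  /eqP; rewrite eq_sym (negPf i21).
Qed.

Let ymax (i : I) : T := [arg max_(y > x0 in M i) k i y].

(** If [M i] has points, order [i] cannot be dropped. Adding the [k i]-highest of them keeps
    dominance: points of [M i] are dominated through [i] only, and every other point through another
    order, whose minimum the new point does not lower. *)
Let neighbour (i : I) : {set T} * {set I} :=
  if M i == set0 then (t, D :\ i) else (ymax i |: t, D).

Let ymaxP i : M i != set0 ->
  ymax i \in M i /\ forall y, y \in M i -> k i y <= k i (ymax i).
Proof.
(* The default [x0] of [ymax] need not lie in [M i], so [arg_maxnP] only yields some maximum, and
   [ymax] is unfolded to reach it. *)
case/set0Pn => y yM; suff /exists_inP[z zM zP] :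
    [exists z in M i, forall y in M i, k i y <= k i z].
  rewrite /ymax /arg_max /extremum; case: pickP => [w /=|/(_ z)/=].
    by case/andP=> wM /forall_inP wP; split.
  by rewrite zM zP.
case: (arg_maxnP (k i) yM) => z zM zP.
by apply/exists_inP; exists z => //; apply/forall_inP.
Qed.

Let M_notin i y : y \in M i -> m @: (D :\ i) = t -> y \notin t.
Proof.
move=> /MP yM mi; apply/negP; rewrite -mi => /imsetP[j].
rewrite !inE => /andP[ji jD] yj.
by have := yM j jD ji; rewrite -yj ltnn.
Qed.

Let neighbour_room i : i \in D -> m @: (D :\ i) = t -> room (neighbour i).
Proof.
move=> iD mi; rewrite /neighbour /room; have [M0|M0] := eqVneq (M i) set0 => /=.
  rewrite dominant_rem M0 eqxx /=.
  by have := cardsD1 i D; rewrite iD -cardD => -[->].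
have [yM yP] := ymaxP M0.
rewrite cardsU1 (M_notin yM) // add1n cardD eqxx andbT.
apply/dominantP => z; have [zM|] := boolP (z \in M i); last first.
  move=> zM; have : exists2 j, j \in D :\ i & k j z <= k j (m j).
    move: zM; rewrite inE negb_forall => /existsP[j].
    by rewrite negb_imply -leqNgt => /andP[jD zj]; exists j.
  case=> j; rewrite !inE => /andP[ji jD] zj; exists j => // x.
  rewrite !inE => /orP[/eqP->|/(m_le j)]; last exact: leq_trans.
  by apply: leq_trans zj (ltnW _); move/MP: yM; apply.
have [j jD jP] := dominantP _ _ dom z.
have ji : j = i.
  apply/eqP/negPn/negP => ji; move/MP: zM => /(_ j jD ji).
  by rewrite ltnNge jP.
rewrite -{}ji in zM yP iD mi yM *.
by exists j => // x; rewrite !inE => /orP[/eqP->|/jP//]; apply: yP.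
Qed.

Let neighbour_incident i : incident (t, D) (neighbour i).
Proof.
rewrite /incident /neighbour; case: ifP => _ /=.
  by rewrite subxx subsetDl.
by rewrite subsetUr subxx.
Qed.

Let incident_neighbour r : room r -> incident (t, D) r ->
  exists i, [/\ i \in D, m @: (D :\ i) = t & r = neighbour i].
Proof.
move=> /andP[domr /eqP cr] inc.
case: (@incident_roomP (t, D) r cardD cr inc) => /= -[z zP rE];
  rewrite {}rE /= in domr cr inc *.
  exists z; split => //; first exact: imset_m.
  by rewrite /neighbour -dominant_rem domr.
(* When a point [z] was added, the order sought is the one in which [z] is the minimum. *)
have [i iD iP] := dominant_min domr (setU11 z t).
have mi : m @: (D :\ i) = t.
  apply/setP => x; apply/imsetP/idP => [[j _ ->]//|xt].
  have [j jD jP] := dominant_min domr (setU1r z xt).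
  exists j; last by apply/esym/m_min => // w wt; apply: jP; rewrite setU1r.
  rewrite !inE jD andbT; apply: contraNneq zP => ji.
  suff -> : z = x by [].
  apply: (@k_inj i); apply/eqP; rewrite eqn_leq iP ?setU1r //= -ji.
  exact/jP/setU11.
(* Each of the [#|D|] points of [z |: t] is the minimum in some order of [D], so none is the minimum
   in two. *)
have inj : {in D &, forall j j', (forall x, x \in z |: t -> k j z <= k j x) ->
   (forall x, x \in z |: t -> k j' z <= k j' x) -> j = j'}.
  move=> j j' jD j'D jP j'P; apply/eqP/negPn/negP => jj'.
  have : #|z |: t| <= #|t|.+1.-1.
    rewrite [in X in _ <= X]cardD.
    pose g j := [arg min_(x < x0 in z |: t) k j x].
    have gP l x : x \in z |: t -> (forall w, w \in z |: t -> k l x <= k l w) ->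
        g l = x.
      move=> xt xP; rewrite /g; case: arg_minnP; first by rewrite setU1r.
      move=> w wt wP; apply: (@k_inj l); apply/eqP.
      by rewrite eqn_leq wP //= xP.
    have -> : #|D|.-1 = #|D :\ j| by rewrite (cardsD1 j D) jD.
    apply: leq_trans (leq_imset_card g _);
      apply/subset_leq_card/subsetP => x xt.
    have [l lD lP] := dominant_min domr xt.
    have [lj|lj] := eqVneq l j.
      have -> : x = z.
        by rewrite -(gP l x) // lj; apply: gP => //; rewrite setU11.
      by apply/imsetP; exists j';
        rewrite ?(gP _ z) ?setU11 // !inE j'D eq_sym jj'.
    by apply/imsetP; exists l; rewrite ?(gP _ x) // !inE lj.
  by rewrite cardsU1 zP add1n ltnn.
have zM : z \in M i.
  apply/MP => j jD ji; rewrite ltnNge; apply: contraNN ji => zj; apply/eqP.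
  apply: inj => // x; rewrite !inE => /orP[/eqP->//|/(m_le j)];
    exact: leq_trans.
exists i; split => //.
have M0 : M i != set0 by apply/set0Pn; exists z.
have [yM yP] := ymaxP M0.
rewrite /neighbour (negPf M0); congr (_ |: _, _).
apply: (@k_inj i); apply/eqP; rewrite eqn_leq yP //=.
(* The room dominates [ymax i] through some order; membership in [M i] rules out all but [i], so
   [ymax i] does not exceed [z]. *)
have [j jD jP] := dominantP _ _ domr (ymax i).
have [ji|ji] := eqVneq j i; first by move: jP; rewrite ji; apply; apply: setU11.
by move/MP: yM => /(_ j jD ji); rewrite ltnNge jP // setU1r.
Qed.

Lemma inner_door_rooms : #|[set r | room r & incident (t, D) r]| = 2.
Proof.
have [i1 [i2 [i1D i2D i12 m12 colP]]] := collision.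
have mD i j : i \in D -> j \in D -> i != j -> m i = m j -> m @: (D :\ i) = t.
  move=> iD jD ij mij; rewrite -(imset_m dom); apply/setP => x.
  apply/imsetP/imsetP => -[l]; first by rewrite !inE => /andP[_ lD] ->;
    exists l.
  have [-> _ ->|li lD ->] := eqVneq l i.
    by exists j; rewrite // !inE eq_sym ij.
  by exists l; rewrite // !inE li.
have m1 := mD _ _ i1D i2D i12 m12.
have m2 : m @: (D :\ i2) = t by apply: (mD i2 i1) => //; rewrite eq_sym.
rewrite (_ : [set r | _ & _] = [set neighbour i1; neighbour i2]).
  rewrite cards2; suff -> : neighbour i1 != neighbour i2 by [].
  have r1 := neighbour_room i1D m1.
  apply/eqP; move: r1; rewrite /neighbour.
  have [M1|M1] := eqVneq (M i1) set0; have [M2|M2] := eqVneq (M i2) set0 => //=.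
  - by move=> _ [] /setP/(_ i1); rewrite !inE eqxx i1D i12.
  - by move=> _ [] _ /setP/(_ i1); rewrite !inE eqxx i1D.
  - by move=> _ [] _ /setP/(_ i2); rewrite !inE eqxx i2D.
  (* If both rooms add a point and coincide, the common point lies in [M i1] and [M i2], hence above
     the minima of [t] in every order of [D], against dominance. *)
  case/andP=> /= dom1 _ [] tE.
  have [/MP y1 _] := ymaxP M1; have [y2M _] := ymaxP M2.
  have y12 : ymax i1 = ymax i2.
    have : ymax i2 \in ymax i1 |: t by rewrite tE setU11.
    by rewrite !inE (negPf (M_notin y2M m2)) orbF => /eqP.
  rewrite -y12 in y2M; move/MP: y2M => y2.
  have [j jD jP] := dominantP _ _ dom1 (ymax i1).
  have := jP _ (setU1r _ (m_in j)); rewrite leqNgt.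
  have [ji|ji] := eqVneq j i1; last by rewrite y1.
  by rewrite y2 // ji.
apply/setP => r; rewrite !inE; apply/andP/orP => [[rr ir]|].
  have [i [iD mi ->]] := incident_neighbour rr ir.
  by have := colP i iD mi; rewrite !inE => /orP[]/eqP->; [left|right].
by case=> /eqP ->; rewrite neighbour_incident neighbour_room.
Qed.

End InnerDoor.

(** * Parity of rooms and doors for a colouring *)

Section Colouring.
Variables (c : T -> I) (i0 : I) (t0 : T).

Let colourful (r : {set T} * {set I}) : bool := room r && (c @: r.1 == r.2).

Let idoor (d : {set T} * {set I}) : bool :=
  [&& door d, i0 \in d.2 & c @: d.1 == d.2 :\ i0].

Let outer_door : {set T} * {set I} := (set0, [set i0]).

Let outer_door_idoor : idoor outer_door.
Proof.
rewrite /idoor /door /= set11 cards0 cards1 eqxx imset0 setDv eqxx !andbT.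
by apply/dominantP => x; exists i0; rewrite ?set11 // => y; rewrite inE.
Qed.

(** Removing the only order leaves none to dominate with, and adding a point gives a room just for
    the [k i0]-maximum of [T]. *)
Let outer_door_rooms : #|[set r | room r & incident outer_door r]| = 1.
Proof.
case: (arg_maxnP (k i0) (isT : predT t0)) => y _ yP.
rewrite (_ : [set r | _ & _] = [set ([set y], [set i0])]) ?cards1 //.
apply/setP => r; rewrite !inE; apply/andP/eqP => [[/andP[domr /eqP cr] inc]|->].
  have := @incident_roomP outer_door r; rewrite /= cards0 cards1.
  case=> // -[z zP rE]; rewrite {}rE /= in domr cr *.
    move: zP domr; rewrite !inE => /eqP -> /dominantP /(_ t0)[i].
    by rewrite setDv inE.
  rewrite setU0 in domr *; have [i] := dominantP _ _ domr y.
  rewrite inE => /eqP -> /(_ z (set11 z)) yz; congr ([set _], _).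
  by apply: (@k_inj i0); apply/eqP; rewrite eqn_leq yz andbT; apply: yP.
rewrite /incident /room /= sub0set subxx !cards1; split=> //; rewrite andbT.
by apply/dominantP => z; exists i0 => [|x]; rewrite inE // => /eqP->; apply: yP.
Qed.

Let idoor_rooms d : idoor d ->
  odd #|[set r | room r & incident d r]| = (d == outer_door).
Proof.
have [-> _|dN] := eqVneq d outer_door; first by rewrite outer_door_rooms.
case: d dN => t D dN /and3P[/andP[/= dom /eqP cD] iD /eqP cE].
have [tE|[x xt]] := set_0Vmem t; last by rewrite (inner_door_rooms dom cD xt).
(* Such a door without points shows no colour, so [i0] is its only order. *)
case/eqP: dN; rewrite tE /outer_door; congr (_, _).
rewrite tE imset0 in cE; apply/setP => i; rewrite inE.
have [->//|ii] := eqVneq i i0.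
by move/setP: cE => /(_ i); rewrite !inE ii.
Qed.

Section RoomDoors.
Variables (s : {set T}) (C : {set I}).
Hypotheses (dom : dominant s C) (cardC : #|s| = #|C|).

(** [A] and [B] encode the doors of the room that miss only [i0]: those that remove a point of [s]
    and those that add an order to [C]. *)
Let A : {set T} := [set x in s | (i0 \in C) && (c @: (s :\ x) == C :\ i0)].
Let B : {set I} :=
  [set i | [&& i \notin C, i0 \in i |: C & c @: s == (i |: C) :\ i0]].

Let room_doors_card :
  #|[set d | idoor d & incident d (s, C)]| = #|A| + #|B|.
Proof.
pose fA x := (s :\ x, C); pose fB i := (s, i |: C).
have -> : [set d | idoor d & incident d (s, C)] = fA @: A :|: fB @: B.
  apply/setP => -[t D]; rewrite !inE; apply/andP/orP; last first.
    case=> /imsetP[z]; rewrite inE => /and3P[].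
      move=> zs iC cE [-> ->]; rewrite /incident /= subsetDl subxx; split=> //.
      rewrite /idoor /door /= iC cE (dominantS _ (subxx C) dom) ?subsetDl //=.
      by rewrite -cardC (cardsD1 z s) zs eqxx.
    move=> zC iC cE [-> ->]; rewrite /incident /= subxx subsetUr; split=> //.
    rewrite /idoor /door /= iC cE (dominantS (subxx s) _ dom) ?subsetUr //=.
    by rewrite cardsU1 zC cardC add1n eqxx.
  case=> /and3P[/andP[/= domd /eqP cD] iD cE] inc.
  case: (@incident_roomP (t, D) (s, C) cD cardC inc) => /= -[z zP [es eC]].
    have DE : D = z |: C by rewrite eC setD1K.
    right; apply/imsetP; exists z; last by rewrite /fB DE es.
    by rewrite inE -DE iD es cE eC !inE eqxx.
  have tE : t = s :\ z by rewrite es setU1K.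
  left; apply/imsetP; exists z; last by rewrite /fA tE eC.
  by rewrite inE -tE eC iD cE es setU11.
rewrite cardsU disjoint_setI0 ?cards0 ?subn0; last first.
  rewrite disjoints_subset; apply/subsetP => _ /imsetP[x xA ->].
  rewrite inE; apply/negP => /imsetP[i _ [/setP/(_ x)]].
  by move: xA; rewrite !inE eqxx => /andP[->].
have injA : {in A &, injective fA}.
  move=> x y; rewrite !inE => /andP[xs _] _ [/setP/(_ x)].
  by rewrite !inE eqxx xs !andbT => /esym/negbFE/eqP.
have injB : {in B &, injective fB}.
  move=> i j; rewrite !inE => /and3P[iC _ _] _ [/setP/(_ i)].
  by rewrite !inE eqxx (negPf iC) !orbF => /esym/eqP.
by rewrite (card_in_imset injA) (card_in_imset injB).
Qed.

(** A colourful room has exactly one such door, any other room none or two. *)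
Lemma room_doors_odd :
  odd #|[set d | idoor d & incident d (s, C)]| = colourful (s, C).
Proof.
rewrite room_doors_card /colourful /room /= dom cardC eqxx /=.
(* If [i0] is not in [C], no point may be removed, and only [i0] may be added. *)
have [iC|iC] := boolP (i0 \in C); last first.
  have -> : A = set0 by apply/setP => x; rewrite !inE (negPf iC) andbF.
  rewrite cards0; have [cE|cE] := boolP (c @: s == C).
    suff -> : B = [set i0] by rewrite cards1.
    apply/setP => i; rewrite !inE (negPf iC) orbF.
    have [<-|] := eqVneq i0 i; last by rewrite !andbF.
    by rewrite iC setU1K.
  suff -> : B = set0 by rewrite cards0.
  apply/setP => i; rewrite !inE (negPf iC) orbF.
  have [<-|] := eqVneq i0 i; last by rewrite andbF.
  by rewrite iC setU1K // (negPf cE).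
have cardA x : x \in A -> {in s :\ x &, injective c}.
  rewrite !inE => /and3P[xs _ /eqP cE]; apply/imset_injP; rewrite cE.
  by apply/eqP/succn_inj; move: cardC;
    rewrite (cardsD1 x s) xs (cardsD1 i0 C) iC.
have rem_colour x : x \in s -> {in s &, injective c} ->
    c @: (s :\ x) = (c @: s) :\ c x.
  move=> xs inj; apply/setP => i; rewrite !inE; apply/imsetP/andP.
    case=> y; rewrite !inE => /andP[yx ys] ->; split; last exact: imset_f.
    by apply: contraNneq yx => /inj ->.
  case=> ix /imsetP[y ys iE]; exists y => //; rewrite !inE ys andbT.
  by apply: contraNneq ix => <-; rewrite iE.
(* In a colourful room only the point of colour [i0] can be removed. *)
have [/eqP cE|cE] := boolP (c @: s == C).
  have inj : {in s &, injective c} by apply/imset_injP; rewrite cE cardC.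
  have -> : B = set0.
    apply/setP => i; rewrite !inE; apply/and3P => -[_ _ /eqP/setP/(_ i0)].
    by rewrite cE !inE iC eqxx.
  have /imsetP[x xs ix] : i0 \in c @: s by rewrite cE.
  rewrite cards0 addn0; suff -> : A = [set x] by rewrite cards1.
  apply/setP => y; rewrite !inE iC /=; apply/andP/eqP => [[ys]|->].
    rewrite rem_colour // cE ix => /eqP/setP/(_ (c y)); rewrite !inE eqxx /=.
    have -> : c y \in C by rewrite -cE imset_f.
    by rewrite andbT => /esym/negbFE/eqP /inj; apply.
  by split=> //; rewrite rem_colour // cE ix.
(* An order in [B] would be the colour of a point whose removal gives a door, so [B] is empty along
   with [A]. *)
have [A0|[x xA]] := set_0Vmem A.
  rewrite A0 cards0; suff -> : B = set0 by rewrite cards0.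
  apply/setP => i; rewrite [RHS]inE; apply/negP; rewrite inE.
  case/and3P=> iN _ /eqP cB.
  have ii0 : i != i0 by apply: contraNneq iN => ->.
  have cB' : c @: s = i |: (C :\ i0).
    rewrite cB; apply/setP => j; rewrite !inE.
    by have [->|] := eqVneq j i; rewrite // ii0.
  have inj : {in s &, injective c}.
    apply/imset_injP; rewrite cB' cardsU1 !inE (negPf iN) andbF add1n cardC.
    by rewrite (cardsD1 i0 C) iC.
  have /imsetP[x xs ix] : i \in c @: s by rewrite cB' setU11.
  have : x \in A.
    by rewrite !inE xs iC rem_colour // cB' -ix setU1K ?eqxx // !inE (negPf iN)
      andbF.
  by rewrite A0 inE.
have := xA; rewrite inE => /and3P[xs _ /eqP cx].
have cs : c @: s = c x |: (C :\ i0) by rewrite -cx -imsetU1 setD1K.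
have cx0 : c x != i0.
  by apply: contraNneq cE => cx0; rewrite cs cx0 setD1K.
(* If the colour of [x] is not in [C], the two doors arise by removing [x] and by adding that
   colour. *)
have [xC|xC] := boolP (c x \in C); last first.
  have -> : A = [set x].
    apply/setP => y; rewrite [RHS]inE; apply/idP/eqP => [yA|->//].
    have := yA; rewrite inE => /and3P[ys _ /eqP cy]; apply/eqP/negPn/negP => yx.
    have : c x \in C :\ i0 by rewrite -cy imset_f // !inE eq_sym yx.
    by rewrite !inE (negPf xC) andbF.
  suff -> : B = [set c x] by rewrite !cards1.
  apply/setP => i; rewrite !inE iC orbT /=; apply/andP/eqP => [[iN /eqP]|->].
    move=> /setP/(_ i); rewrite cs !inE eqxx (negPf iN) andbF orbF andbT.
    have -> : i != i0 by apply: contraNneq iN => ->.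
    by move/eqP.
  split=> //; rewrite cs; apply/eqP/setP => j; rewrite !inE.
  by have [->|] := eqVneq j (c x); rewrite // cx0.
(* Otherwise a second point of [s] has the colour of [x], and the two doors arise by removing either
   point. *)
have cs' : c @: s = C :\ i0.
  by rewrite cs; apply/setUidPr; rewrite sub1set !inE cx0.
have -> : B = set0.
  apply/setP => i; rewrite !inE iC orbT /=; apply/andP => -[iN /eqP/setP/(_ i)].
  rewrite cs' !inE eqxx (negPf iN) andbF /= andbT => /esym/negbFE/eqP ii.
  by rewrite ii iC in iN.
have /imsetP[x' x's xx'] : c x \in c @: (s :\ x) by rewrite cx !inE cx0.
have x'x : x' != x by move: x's; rewrite !inE => /andP[].
have {}x's : x' \in s by move: x's; rewrite !inE => /andP[].
suff -> : A = [set x; x'] by rewrite cards2 eq_sym x'x cards0.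
apply/setP => y; rewrite [RHS]inE !inE iC /=; apply/andP/orP => [[ys cy]|].
  have yA : y \in A by rewrite inE ys iC.
  have [_|yx] := eqVneq y x; first by left.
  have [_|yx'] := eqVneq y x'; first by right.
  have := cardA y yA x x'; rewrite !inE ![_ == y]eq_sym yx yx' xs x's.
  by move=> /(_ isT isT xx') xx; rewrite xx eqxx in x'x.
case=> /eqP ->; first by rewrite cx.
split=> //.
rewrite -cs'; apply/eqP/setP => i; apply/imsetP/imsetP => -[w].
  by rewrite !inE => /andP[_ ws] ->; exists w.
have [-> _ ->|wx' ws ->] := eqVneq w x'.
  by exists x; rewrite // !inE eq_sym x'x.
by exists w; rewrite // !inE wx'.
Qed.

End RoomDoors.

(* Double counting modulo 2 of the incidences between rooms and the doors
   missing only the colour [i0]: just the outer door has an odd number of rooms,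
   and just the colourful rooms have an odd number of such doors. *)
Lemma dominant_colourful : exists (X : {set T}) (C : {set I}),
  dominant X C /\ c @: X = C.
Proof.
have : odd (\sum_(d | idoor d) #|[set r | room r & incident d r]|).
  rewrite (bigD1 outer_door) //= oddD outer_door_rooms /=.
  rewrite (big_morph odd oddD (erefl _)) big1 // => d /andP[/idoor_rooms ->].
  by move/negPf.
have -> : \sum_(d | idoor d) #|[set r | room r & incident d r]| =
          \sum_(r | room r) #|[set d | idoor d & incident d r]|.
  under eq_bigr do rewrite -sum1_card.
  under [RHS]eq_bigr do rewrite -sum1_card.
  rewrite (exchange_big_dep room) /=; last by move=> d r _;
    rewrite inE => /andP[].
  apply: eq_bigr => r rr; apply: eq_bigl => d; rewrite !inE.
  by rewrite rr.
rewrite (big_morph odd oddD (erefl _)) => oddr.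
have [[X C] /andP[/andP[dom _] /eqP cX]|none] := pickP colourful.
  by exists X, C.
move: oddr; rewrite big1 // => -[s C] /andP[dom /eqP cC].
by rewrite room_doors_odd //; apply: none.
Qed.

End Colouring.

End Dominance.

(** * Colourings of the integer points of a dilated simplex *)

Section Grid.
Import fintype boot.finset.
Variables (n N : nat).

Definition grid := {a : {ffun 'I_n.+1 -> 'I_N.+1} | \sum_i (a i : nat) == N}.

(** This compares coordinate [i] and breaks ties by enumeration; the factor exceeds every rank. *)
Let key (i : 'I_n.+1) (a : grid) : nat := sval a i * #|{: grid}| + enum_rank a.

Let grid_gt0 (a : grid) : 0 < #|{: grid}|. Proof. by apply/card_gt0P;
  exists a. Qed.

Let key_inj i : injective (key i).
Proof.
move=> a b /(congr1 (modn^~ #|{: grid}|)); rewrite !modnMDl !modn_small //.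
by move/val_inj/enum_rank_inj.
Qed.

Let key_le i (a b : grid) : key i a <= key i b -> sval a i <= sval b i.
Proof.
move/(leq_div2r #|{: grid}|).
by rewrite !divnMDl ?(grid_gt0 a) // !divn_small // !addn0.
Qed.

Let gridE (a : grid) : \sum_i (sval a i : nat) = N.
Proof. by case: a => a /= /eqP. Qed.

Let grid_ge (m : 'I_n.+1 -> nat) : \sum_i m i <= N ->
  exists a : grid, forall i, m i <= sval a i.
Proof.
move=> mN; pose d := N - \sum_i m i.
pose g i := m i + (i == ord0) * d.
have gE : \sum_i g i = N.
  have dE : \sum_(i < n.+1) (i == ord0) * d = d.
    by rewrite (bigD1 ord0) //= big1 ?addn0 ?mul1n // => i /negPf->.
  by rewrite big_split /= dE subnKC.
have gN i : g i < N.+1 by rewrite ltnS -[X in _ <= X]gE (bigD1 i) //= leq_addr.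
have gP : \sum_i ([ffun i => Ordinal (gN i)] i : nat) == N.
  by apply/eqP; rewrite -[RHS]gE; apply: eq_bigr => i _; rewrite ffunE.
by exists (exist _ [ffun i => Ordinal (gN i)] gP : grid) => i;
  rewrite ffunE leq_addr.
Qed.

(** Dominance forces the coordinate minima of [X] over [C] to add up to almost [N]. Hence the points
    of [X] differ by at most [n] in each coordinate, and the coordinates outside [C] are at most
    [n]. *)
Lemma grid_colouring (c : grid -> 'I_n.+1) : exists a : grid, forall i,
  sval a i <= n \/
  exists2 b : grid, c b = i &
    forall j, sval a j <= sval b j + n /\ sval b j <= sval a j + n.
Proof.
have [|t0 _] := @grid_ge (fun=> 0); first by rewrite big1.
have [X [C [dom cX]]] := dominant_colourful key_inj c ord0 t0.
have [i1 i1C _] := dominantP _ _ _ dom t0.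
have /imsetP[a0 a0X _] : i1 \in c @: X by rewrite cX.
pose x (i : 'I_n.+1) := [arg min_(y < a0 in X) key i y].
pose m (i : 'I_n.+1) : nat := sval (x i) i.
have xX i : x i \in X by rewrite /x; case: arg_minnP.
have m_le i y : y \in X -> m i <= sval y i.
  by move=> yX; apply: key_le; rewrite /x; case: arg_minnP => // z _; apply.
(* Otherwise some grid point would exceed all these minima, against dominance. *)
have mN : N < \sum_(i in C) (m i).+1.
  rewrite ltnNge; apply/negP; rewrite big_mkcond => /grid_ge[t tP].
  have [i iC iP] := dominantP _ _ _ dom t.
  have := tP i; rewrite iC leqNgt ltnS.
  by rewrite key_le // iP.
(* [C] has at most [n.+1] elements, and the strict inequality saves one. *)
have {}mN : N <= \sum_(i in C) m i + n.
  rewrite -ltnS -addnS; apply: leq_trans mN _.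
  under eq_bigr do rewrite -addn1; rewrite big_split /= leq_add2l sum1_card.
  by rewrite -[X in _ <= X]card_ord max_card.
have inC i y : i \in C -> y \in X -> sval y i <= m i + n.
  move=> iC yX; rewrite -(leq_add2r (\sum_(j in C | j != i) m j)).
  rewrite addnAC -(bigD1 i) //=; apply: leq_trans _ mN.
  rewrite -[X in _ <= X](gridE y) [X in _ <= X](bigD1 i) //= leq_add2l.
  rewrite [X in X <= _]big_mkcond [X in _ <= X]big_mkcond /=.
  by apply: leq_sum => j _; case: (j \in C); case: (j != i); rewrite ?m_le.
have outC i y : i \notin C -> y \in X -> sval y i <= n.
  move=> iC yX; rewrite -(leq_add2l (\sum_(j in C) m j)).
  apply: leq_trans _ mN; rewrite -[X in _ <= X](gridE y) [X in _ <= X](bigD1 i)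
    //= addnC.
  rewrite leq_add2l [X in X <= _]big_mkcond [X in _ <= X]big_mkcond /=.
  apply: leq_sum => j _; case: ifP => // jC; rewrite (_ : j != i) ?m_le //.
  by apply: contraNneq iC => <-.
exists a0 => i; have [iC|iC] := boolP (i \in C); last by left; apply: outC.
right; have /imsetP[b bX ->] : i \in c @: X by rewrite cX.
exists b => // j; have [jC|jC] := boolP (j \in C); last first.
  by split; apply: leq_trans (outC j _ jC _) (leq_addl _ _).
by split; apply: leq_trans (inC j _ jC _) _ => //; rewrite leq_add2r m_le.
Qed.

End Grid.

(** * Brouwer's fixed point theorem on a simplex *)

Local Open Scope classical_set_scope.
Local Open Scope ring_scope.

Section Brouwer.
Variables (R : realType) (n : nat).

Definition simplex : set 'rV[R]_n.+1 :=
  [set x | (forall i, 0 <= x ord0 i) /\ \sum_i x ord0 i = 1].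

Lemma simplex_le1 x i : simplex x -> x ord0 i <= 1.
Proof.
move=> [x0 <-]; rewrite (bigD1 i) //= lerDl; apply: sumr_ge0 => j _; exact: x0.
Qed.

Lemma compact_simplex : compact simplex.
Proof.
apply: (subclosed_compact _ (@rV_compact R n.+1 (fun=> `[0, 1]%classic)
  (fun=> @segment_compact _ _ _))).
- rewrite (_ : simplex = (\bigcap_i (fun x : 'rV[R]_n.+1 => x ord0 i) @^-1`
      [set y | 0 <= y]) `&`
      (fun x : 'rV[R]_n.+1 => \sum_i x ord0 i) @^-1` [set 1]); last first.
    apply/seteqP; split=> x [x0 x1]; split=> // i; first by move=> _; apply: x0.
    exact: x0.
  apply: closedI.
    apply: closed_bigI => i _; apply: preimage_closed; last exact: closed_ge.
    by move=> x _; apply: coord_continuous.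
  apply: preimage_closed; last exact: closed_eq.
  move=> x _; apply: continuous_big => [|i _]; first exact: add_continuous.
  exact: coord_continuous.
- move=> x xs i /=; rewrite in_itv /= simplex_le1 // andbT; exact: xs.1.
Qed.

Let grid_point N (a : grid n N.+1) : 'rV[R]_n.+1 :=
  \row_i ((sval a i)%:R / N.+1%:R).

Let grid_point_simplex N (a : grid n N.+1) : simplex (grid_point a).
Proof.
split=> [i|]; first by rewrite mxE divr_ge0.
under eq_bigr do rewrite mxE.
rewrite -mulr_suml -natr_sum (eqP (svalP a)) divff // pnatr_eq0 //.
Qed.

(* The Petri-Voorneveld argument: colour a grid point by a coordinate that [f]
   does not decrease; a coordinate decreasing at a cluster point of the
   dominant sets would have to occur as a colour nearby. *)
Theorem brouwer_simplex (f : 'rV[R]_n.+1 -> 'rV[R]_n.+1) :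
  (forall x, simplex x -> simplex (f x)) ->
  (forall i, {within simplex, continuous (fun x => f x ord0 i)}) ->
  exists2 x, simplex x & f x = x.
Proof.
move=> fs fc.
have colourP x : simplex x -> exists i, x ord0 i <= f x ord0 i.
  move=> xs; apply: contrapT => /forallNP fx.
  have : \sum_i f x ord0 i < \sum_i x ord0 i.
    apply: ltr_sum => [|i _]; last by rewrite ltNge; apply/negP/fx.
    by apply/hasP; exists ord0; rewrite // mem_index_enum.
  by rewrite (fs x xs).2 xs.2 ltxx.
pose c N (a : grid n N.+1) : 'I_n.+1 := projT1 (cid (colourP _
  (grid_point_simplex a))).
have cP N (a : grid n N.+1) :
    grid_point a ord0 (c N a) <= f (grid_point a) ord0 (c N a).
  exact: projT2 (cid (colourP _ (grid_point_simplex a))).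
pose a N : grid n N.+1 := projT1 (cid (grid_colouring (c N))).
have aP N i : (sval (a N) i <= n)%N \/ exists2 b : grid n N.+1, c N b = i &
    forall j, (sval (a N) j <= sval b j + n)%N /\ (sval b j <= sval (a N) j +
      n)%N.
  by have := projT2 (cid (grid_colouring (c N))); apply.
pose p N := grid_point (a N).
have [x [xs clx]] : exists x, simplex x /\ cluster (p @ \oo) x.
  have [|x [xs clx]] := @compact_simplex (p @ \oo) _.
    by exists 0%N => // N _; apply: grid_point_simplex.
  by exists x.
exists x => //.
(* Both coordinate sums are 1, so no inequality can be strict. *)
suff le i : x ord0 i <= f x ord0 i.
  apply/rowP => i; apply/eqP/negPn/negP => ne.
  have : \sum_i x ord0 i < \sum_i f x ord0 i.
    rewrite [ltLHS](bigD1 i) // [ltRHS](bigD1 i) //= ltr_leD ?ler_sum //.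
    by rewrite lt_neqAle eq_sym ne le.
  by rewrite (fs x xs).2 xs.2 ltxx.
rewrite leNgt; apply/negP => fxi.
have nearx : \forall y \near x, simplex y -> f y ord0 i < y ord0 i.
  have /subspace_continuousP/(_ x xs) fi := fc i.
  have ci : (fun y : 'rV[R]_n.+1 => y ord0 i) @ within simplex (nbhs x) --> x
    ord0 i.
    by apply: cvg_within_filter; apply: coord_continuous.
  have := cvgr_gt _ (cvgB ci fi) 0; rewrite subr_gt0 => /(_ _ _ fxi).
  by rewrite near_withinE; apply: filterS => y h /h {}h; rewrite -subr_gt0;
    exact: h.
have xi0 : 0 < x ord0 i by apply: le_lt_trans fxi; exact: (fs x xs).1.
have /nbhs_ballP[e /= e0 eP] := nearx.
(* Two errors of size [d] must stay inside the ball of radius [e] and must not bring coordinate [i]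
   of [x] down to 0. *)
pose d := Num.min e (x ord0 i) / 2.
have d0 : 0 < d by rewrite divr_gt0 // lt_min e0 xi0.
have clxB : (p @ \oo) [set y | exists2 N, n%:R / N.+1%:R < d & y = p N].
  exists (Num.truncn (n%:R / d)) => // N /= leN; exists N => //.
  rewrite ltr_pdivrMr ?ltr0n // mulrC -ltr_pdivrMr //.
  by apply: lt_le_trans (truncnS_gt _) _; rewrite ler_nat ltnS.
have [_ [[N Nd ->] xp]] := clx _ _ clxB (nbhsx_ballx x d d0).
have coord j : `|x ord0 j - p N ord0 j| < d.
  by move: xp; rewrite /ball /= => -[_ /(_ ord0 j)].
have d2 : d * 2 = Num.min e (x ord0 i) by rewrite divfK.
have [de dx] : d * 2 <= e /\ d * 2 <= x ord0 i by rewrite d2 !ge_min !lexx orbT.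
(* A coordinate at most [n] would put [p N] too far from [x]; a point [b] of colour [i] lies where
   [f] decreases coordinate [i]. *)
have [ai|[b cb ab]] := aP N i.
  have : p N ord0 i < d.
    apply: le_lt_trans Nd; by rewrite mxE ler_pM2r ?invr_gt0 ?ltr0n // ler_nat.
  by have := coord i; rewrite ltr_distlC => /andP[h1 h3] h2; lra.
have : f (grid_point b) ord0 i < grid_point b ord0 i.
  apply: eP; last exact: grid_point_simplex.
  split=> // i' j; rewrite ord1 /ball /=.
  have : `|p N ord0 j - grid_point b ord0 j| < d.
    apply: le_lt_trans Nd; rewrite !mxE -mulrBl normrM [X in _ * X]ger0_norm
      ?invr_ge0 //.
    rewrite ler_pM2r ?invr_gt0 ?ltr0n // ler_distl -!natrD.
    have [h1 h2] := ab j; rewrite lerBlDr -natrD !ler_nat; exact/andP.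
  have := coord j; rewrite !ltr_norml => /andP[h1 h2] /andP[h3 h4].
  by apply/andP; split; lra.
by rewrite ltNge -cb cP.
Qed.

End Brouwer.

(** * Schauder's fixed point theorem *)

Lemma cvg_within_set (S : Type) (T : topologicalType) (F : set_system S)
    (FF : Filter F) (B : set T) (h : S -> T) (y : T) :
  h @ F --> y -> (\forall x \near F, B (h x)) -> h @ F --> within B (nbhs y).
Proof.
move=> hy hB A /hy; apply: filterS2 hB => x Bx Ax; exact: Ax.
Qed.

Lemma cvg_maxr (R : realType) (T : Type) (F : set_system T) (FF : Filter F)
    (f g : T -> R) (a b : R) :
  f @ F --> a -> g @ F --> b -> Num.max (f x) (g x) @[x --> F] --> Num.max a b.
Proof. move=> fa gb; apply: continuous2_cvg => //;
  exact: (@max_continuous _ R (a, b)). Qed.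

Lemma cvg_minr (R : realType) (T : Type) (F : set_system T) (FF : Filter F)
    (f g : T -> R) (a b : R) :
  f @ F --> a -> g @ F --> b -> Num.min (f x) (g x) @[x --> F] --> Num.min a b.
Proof. move=> fa gb; apply: continuous2_cvg => //;
  exact: (@min_continuous _ R (a, b)). Qed.

Lemma convex_setE (R : realType) (E : lmodType R) (C : set E) :
  convex_set C <-> forall (x y : E) (t : R), C x -> C y -> 0 <= t -> t <= 1 ->
    C (t *: x + (1 - t) *: y).
Proof.
split=> [cC x y t Cx Cy t0 t1|cC x y t /set_mem Cx /set_mem Cy].
  have := cC x y (Itv01 t0 t1); rewrite !inE => h; exact: h.
by apply/mem_set; apply: cC.
Qed.

Lemma convex_combination (R : realType) (E : lmodType R) (C : set E)
    (J : eqType) (s : seq J) (w : J -> R) (c : J -> E) : convex_set C ->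
  (forall j, C (c j)) -> (forall j, 0 <= w j) -> \sum_(j <- s) w j = 1 ->
  C (\sum_(j <- s) w j *: c j).
Proof.
move=> /convex_setE cC Cc; elim: s w => [|j s IHs] w w0.
  by rewrite big_nil => /esym/eqP; rewrite oner_eq0.
rewrite !big_cons; set W := \sum_(i <- s) w i => wW.
have W0 : 0 <= W by apply: sumr_ge0.
have [WE|WN] := eqVneq W 0.
  have -> : \sum_(i <- s) w i *: c i = 0.
    rewrite big1_seq // => i /= si; move/eqP: WE; rewrite psumr_eq0 //.
    by move=> /allP/(_ i si)/eqP ->; rewrite scale0r.
  by rewrite addr0; rewrite WE addr0 in wW; rewrite wW scale1r.
have -> : \sum_(i <- s) w i *: c i = (1 - w j) *: \sum_(i <- s) (w i / W) *: c
  i.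
  rewrite -wW addrC addKr scaler_sumr; apply: eq_bigr => i _.
  by rewrite scalerA mulrC divfK.
apply: cC => //; last by rewrite -wW lerDl.
by apply: IHs => [i|]; rewrite ?divr_ge0 // -mulr_suml divff.
Qed.

Section Schauder.
Variables (R : realType) (E : normedModType R) (C L : set E) (f : E -> E).
Hypotheses (convexC : convex_set C) (closedC : closed C) (C0 : C !=set0).
Hypotheses (fC : forall x, C x -> C (f x)) (fcont : {within C, continuous f}).
Hypotheses (compactL : compact L) (fL : forall x, C x -> L (f x)).

Let cvg_f x : C x -> f @ within C (nbhs x) --> f x.
Proof. exact: (subspace_continuousP _ _).1. Qed.

(** Covering the part of [L] inside [C] puts the net in [C], so convex combinations of it stay
    there. *)
Let finite_net (e : R) : 0 < e -> exists n (c : 'I_n.+1 -> E),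
  (forall i, C (c i)) /\ forall x, C x -> exists i, `|f x - c i| < e.
Proof.
move=> e0; have := compact_closedI compactL closedC.
rewrite compact_cover => /(_ _ (L `&` C) (fun z => (ball z e)°)).
have [x0 Cx0] := C0.
case=> [z _|z LCz|D DLC LCD].
- exact: open_interior.
- by exists z => //; apply: nbhsx_ballx.
pose s : seq E := finmap.enum_fset D.
have net x : C x -> exists2 z, z \in s & `|f x - z| < e.
  move=> Cx; have [z /= zD /interior_subset] := LCD _ (conj (fL Cx) (fC Cx)).
  by rewrite -ball_normE /= distrC; exists z.
have [z0 z0D _] := net _ Cx0.
have n0 : (0 < size s)%N by move: z0D; case: (s).
exists (size s).-1, (fun i => nth z0 s i); split=> [i|x /net[z zs xz]].
  have : nth z0 s i \in s by apply: mem_nth;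
    rewrite -[X in (_ < X)%N](prednK n0).
  by move/DLC; rewrite inE => -[].
have zi : (index z s < (size s).-1.+1)%N by rewrite prednK // index_mem.
by exists (Ordinal zi); rewrite /= nth_index.
Qed.

(** This is the Schauder projection: [f y] is replaced by an average of net points within [e] of it,
    and Brouwer's theorem is applied to the weights. *)
Let approximate_fixpoint (e : R) : 0 < e -> exists2 x, C x & `|x - f x| <= e.
Proof.
move=> e0; have [n [c [Cc net]]] := finite_net e0.
pose w i z : R := Num.max 0 (e - `|z - c i|).
have w_ge0 i z : 0 <= w i z by rewrite le_max lexx.
pose W z := \sum_i w i z.
have W_gt0 x : C x -> 0 < W (f x).
  move=> /net[i xi]; rewrite /W (bigD1 i) //= ltr_wpDr ?sumr_ge0 //.
  by rewrite lt_max subr_gt0 xi orbT.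
have wc i : continuous (w i).
  move=> z; apply: cvg_maxr; first exact: cvg_cst.
  apply: cvgB; first exact: cvg_cst.
  by apply: cvg_norm; apply: cvgB; [exact: cvg_id|exact: cvg_cst].
have Wc : continuous W.
  by apply: continuous_big => [|i _]; [exact: add_continuous|exact: wc].
pose h (x : 'rV[R]_n.+1) := \sum_i x ord0 i *: c i.
have hC x : simplex x -> C (h x).
  by move=> [x0 x1]; apply: convex_combination.
have hc : continuous h.
  apply: continuous_big => [|i _]; first exact: add_continuous.
  move=> x; exact: (cvgZr_tmp (@coord_continuous R 1 n.+1 ord0 i x)).
pose g (x : 'rV[R]_n.+1) : 'rV[R]_n.+1 := \row_i (w i (f (h x)) / W (f (h x))).
have gs x : simplex x -> simplex (g x).
  move=> /hC hx; have W0 := W_gt0 _ hx; split=> [i|].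
    by rewrite mxE divr_ge0 // ltW.
  by under eq_bigr do rewrite mxE; rewrite -mulr_suml divff // gt_eqF.
have [i|x xs gx] := brouwer_simplex gs.
  rewrite (_ : (fun y => _) = fun y => w i (f (h y)) / W (f (h y))); last first.
    by apply/funext => y; rewrite mxE.
  apply/subspace_continuousP => x xs.
  have fh : f (h y) @[y --> within (@simplex R n) (nbhs x)] --> f (h x).
    apply: cvg_comp (cvg_f (hC _ xs)); apply: cvg_within_set.
      by apply: cvg_within_filter; exact: hc.
    by rewrite near_withinE; apply: nearW.
  apply: cvgM; first exact: cvg_comp fh (wc i _).
  apply: cvgV; first by rewrite gt_eqF // W_gt0 //; apply: hC.
  exact: cvg_comp fh (Wc _).
exists (h x); first exact: hC.
have W0 := W_gt0 _ (hC _ xs); set y := h x in W0 *.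
(* With the same weights on both sides, only net points within [e] of [f y] contribute to the
   difference. *)
have yE : y = \sum_i (w i (f y) / W (f y)) *: c i.
  by rewrite {1}/y /h -{1}gx; apply: eq_bigr => i _; rewrite mxE.
have fyE : f y = \sum_i (w i (f y) / W (f y)) *: f y.
  by rewrite -scaler_suml -mulr_suml divff ?gt_eqF // scale1r.
rewrite {1}yE [X in _ - X]fyE -sumrB.
apply: le_trans (ler_norm_sum _ _ _) _.
have -> : e = \sum_i (w i (f y) / W (f y)) * e.
  by rewrite -mulr_suml -mulr_suml divff ?gt_eqF // mul1r.
apply: ler_sum => i _; rewrite -scalerBr normrZ ger0_norm ?divr_ge0 ?(ltW W0)
  //.
have [wi|] := ltP 0 (w i (f y)); last first.
  move=> wi; have -> : w i (f y) = 0 by apply/eqP; rewrite eq_le wi w_ge0.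
  by rewrite !mul0r.
rewrite ler_wpM2l ?divr_ge0 ?(ltW W0) //.
by move: wi; rewrite lt_max ltxx /= subr_gt0 distrC => /ltW.
Qed.

(** A cluster point of the images of ever better approximate fixed points is fixed. *)
Theorem schauder : exists2 x, C x & f x = x.
Proof.
pose e k : R := k.+1%:R^-1; have e0 k : 0 < e k by rewrite invr_gt0 ltr0n.
pose x k := projT1 (cid2 (approximate_fixpoint (e0 k))).
have Cx k : C (x k) by rewrite /x; case: cid2.
have xe k : `|x k - f (x k)| <= e k by rewrite /x; case: cid2.
have [|z [Lz clz]] := @compactL ((f \o x) @ \oo) _.
  by exists 0%N => // k _; apply: fL.
have near_z (d : R) : 0 < d -> exists k, e k < d /\ `|z - f (x k)| < d.
  move=> d0.
  have clB : ((f \o x) @ \oo) [set y | exists2 k, e k < d & y = f (x k)].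
    exists (Num.truncn d^-1) => // k /= lek; exists k => //.
    rewrite invf_plt ?posrE ?ltr0n //.
    by apply: lt_le_trans (truncnS_gt _) _; rewrite ler_nat ltnS.
  have [_ [[k kd ->] zk]] := clz _ _ clB (nbhsx_ballx z d d0).
  by exists k; split=> //; move: zk; rewrite -ball_normE.
have Cz : C z.
  rewrite (closure_id C).1 // => B /nbhs_ballP[d /= d0 dB].
  have [k [_ zk]] := near_z _ d0; exists (f (x k)); split; first exact: fC.
  by apply: dB; rewrite -ball_normE.
exists z => //; apply/eqP/negPn/negP => fz.
(* For suitable [k], [f (x k)] is within a third of the distance from [z], and [x k] is so close to
   [z] that [f (x k)] is also within a third of it from [f z]. *)
have d0 : 0 < `|f z - z| / 3 by rewrite divr_gt0 // normr_gt0 subr_eq0.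
have /cvgrPdist_lt/(_ _ d0) := cvg_f Cz; rewrite near_withinE.
move=> /nbhs_ballP[r /= r0 rP].
have [|k [ek zk]] := near_z (Num.min (r / 2) (`|f z - z| / 3)).
  by rewrite lt_min d0 divr_gt0.
move: ek zk; rewrite !lt_min => /andP[er ed] /andP[zr zd].
have xz : `|z - x k| < r.
  have := ler_distD (f (x k)) z (x k); rewrite [`|f _ - _|]distrC.
  by have := xe k; lra.
have := rP (x k); rewrite -ball_normE /= => /(_ xz (Cx k)) fzx.
have := ler_distD (f (x k)) (f z) z; rewrite [`|f (x k) - _|]distrC.
by lra.
Qed.

End Schauder.

(** * Homotopies in a ring of a cone *)

Lemma urysohn_separation_pm (R : realType) (S : pseudoMetricType R)
    (A B : set S) : closed A -> closed B -> A `&` B = set0 ->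
  exists u : S -> R, [/\ continuous u, forall x, 0 <= u x <= 1,
    forall x, A x -> u x = 0 & forall x, B x -> u x = 1].
Proof.
move=> cA cB AB; exists (Urysohn A B).
have sepAB : uniform_separator A B.
  exact: (normal_uniform_separator pseudometric_normal).
split.
- exact: Urysohn_continuous.
- by move=> x; have := @Urysohn_range _ R A B (Urysohn A B x) (ex_intro2 _ _ x
  I erefl);
    rewrite /= in_itv.
- by move=> x Ax; apply: (Urysohn_sub0 sepAB); exists x.
- by move=> x Bx; apply: (Urysohn_sub1 sepAB); exists x.
Qed.

Lemma closed_setX (S V : topologicalType) (A : set S) (B : set V) :
  closed A -> closed B -> closed (A `*` B).
Proof.
move=> cA cB; rewrite (_ : A `*` B = fst @^-1` A `&` snd @^-1` B) //.
apply: closedI; apply: preimage_closed => //.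
  by move=> z _; exact: cvg_fst.
by move=> z _; exact: cvg_snd.
Qed.

Lemma closed_within_preimage (S V : topologicalType) (A : set S) (N : set V)
    (g : S -> V) : closed A -> closed N -> {within A, continuous g} ->
  closed (A `&` g @^-1` N).
Proof.
move=> cA cN gc; rewrite closed_setSI //.
by have /continuous_closedP := gc; apply.
Qed.

Lemma bounded_setP (R : realType) (V : normedModType R) (A : set V) :
  bounded_set A -> exists2 c : R, 0 <= c & forall x, A x -> `|x| <= c.
Proof.
case=> M [_ MP]; exists (Num.max 0 M + 1);
  first by rewrite addr_ge0 // le_max lexx.
by move=> x; apply: MP; rewrite ltr_pwDr // le_max lexx orbT.
Qed.

(** The cutoff [a] erases discontinuities of the bounded map [g] where its limit is 0. *)
Lemma cvgZ_cutoff (R : realType) (S : Type) (F : set_system S) (FF : Filter F)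
    (V : normedModType R) (a : S -> R) (a0 : R) (g : S -> V) (v : V) (c : R) :
  (forall x, `|g x| <= c) -> a @ F --> a0 -> a0 = 0 \/ g @ F --> v ->
  a x *: g x @[x --> F] --> a0 *: v.
Proof.
move=> gc aa [a00|gv]; last exact: cvgZ aa gv.
rewrite a00 scale0r; apply: norm_cvg0.
apply: (@squeeze_cvgr _ _ _ _ (fun=> 0) (fun x => `|a x| * c)).
- by apply: nearW => x; rewrite normr_ge0 normrZ ler_wpM2l.
- exact: cvg_cst.
- by rewrite -[X in _ --> X](mul0r c) -(normr0 R) -a00; apply: cvgMr_tmp;
  apply: cvg_norm.
Qed.

Section Cone.
Variables (R : realType) (X : normedModType R) (K : set X).
Hypothesis coneK : is_cone K.

Lemma coneZ x t : K x -> 0 <= t -> K (t *: x).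
Proof. by case: coneK => _ _ KZ _; apply: KZ. Qed.

Lemma coneD x y : K x -> K y -> K (x + y).
Proof.
case: coneK => _ /convex_setE cK KZ _ Kx Ky.
have -> : x + y = 2^-1 *: (2 *: x) + (1 - 2^-1) *: (2 *: y).
  rewrite !scalerA mulVf ?pnatr_eq0 // scale1r.
  by rewrite (_ : (1 - 2^-1) * 2 = 1 :> R) ?scale1r //; field.
by apply: cK; rewrite ?invr_ge0 ?invf_le1 ?ler1n //; apply: KZ.
Qed.

Lemma coneNN x : K x -> K (- x) -> x = 0.
Proof.
case: coneK => _ _ _ KK Kx KNx.
have : (K `&` [set - u | u in K]) x by split=> //; exists (- x); rewrite ?opprK.
by rewrite KK.
Qed.

End Cone.

Section Homotopy.
Variables (R : realType) (X Y : normedModType R).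
Variables (K P Q : set X) (D : set Y) (T : X * Y -> X * Y) (h : X) (y0 : Y).
Hypothesis coneK : is_cone K.
Hypotheses (closedD : closed D) (convexD : convex_set D) (Dy0 : D y0).
Hypotheses (closedP : closed P) (closedQ : closed Q) (PQ : P `&` Q = set0).
(** [P] is the side carrying (ii) and [Q] the side carrying (i). Leaving open which is the inner one
    serves compression and expansion alike. *)
Let W : set X := K `\` (P `|` Q).
Let A : set (X * Y) := closure W `*` D.
Hypotheses (TKD : forall z, A z -> (K `*` D) (T z))
  (Tcont : {within A, continuous T}) (Tcomp : precompact (T @` A)).
Hypotheses (Kh : K h) (h0 : h <> 0).
(** This is (ii) with the scalar inverted and moved to the image; [l = 0] adds that [x] is
    nonzero. *)
Hypothesis (condP : forall x y l, closure W x -> P x -> D y ->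
  0 <= l -> l <= 1 -> l *: (T (x, y)).1 <> x).
Hypothesis (condQ : forall x y m, closure W x -> Q x -> D y ->
  0 <= m -> (T (x, y)).1 + m *: h <> x).
Hypothesis no_fixpoint : forall z, W z.1 -> D z.2 -> T z <> z.

Let closedK : closed K. Proof. by case: coneK. Qed.

Let closedA : closed A.
Proof. by apply: closed_setX => //; exact: closed_closure. Qed.

Let T1cont : {within A, continuous (fun z => (T z).1)}.
Proof.
move=> z; apply: (@continuous_comp (subspace A) _ _ T fst); first exact: Tcont.
exact: cvg_fst.
Qed.

Let idcont : {within A, continuous (fun z => z.1)}.
Proof. by apply: continuous_subspaceT => z; exact: cvg_fst. Qed.

(* In [A], [Zl] is the set where [z.1 = l *: (T z).1] for some [0 <= l <= 1],
   and [Zm] the set where [z.1 = (T z).1 + m *: h] for some [m >= 0], written so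
   that closedness needs no compactness of the parameter. *)
Let Zl : set (X * Y) := A `&` (fun z =>
  Num.max `| `|(T z).1| *: z.1 - `|z.1| *: (T z).1 | (`|z.1| - `|(T z).1|))
  @^-1` [set t | t <= 0].

Let Zm : set (X * Y) := A `&` (fun z =>
  `| `|h| *: (z.1 - (T z).1) - `|z.1 - (T z).1| *: h |) @^-1` [set t | t <= 0].

Let closedZl : closed Zl.
Proof.
apply: closed_within_preimage; [exact: closedA|exact: closed_le|] => z.
have T1c := @T1cont z; have idc := @idcont z.
apply: cvg_maxr; first apply: cvg_norm; apply: cvgB; try apply: cvgZ;
  by [|apply: cvg_norm].
Qed.

Let closedZm : closed Zm.
Proof.
apply: closed_within_preimage; [exact: closedA|exact: closed_le|] => z.
have subc : (fun w => w.1 - (T w).1) @ nbhs (z : subspace A) --> z.1 - (T z).1.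
  exact: (cvgB (@idcont z) (@T1cont z)).
apply: cvg_norm; apply: cvgB; apply: cvgZ; try exact: cvg_cst.
  exact: subc.
by have := cvg_norm subc; apply.
Qed.

Let h_gt0 : 0 < `|h|.
Proof. by rewrite normr_gt0; apply/eqP. Qed.

Let ZlP z : Zl z -> ~ P z.1.
Proof.
case=> -[Wz Dz] /=; rewrite ge_max normr_le0 subr_eq0 subr_le0.
move=> /andP[/eqP e le] Pz.
have [T0|TN] := eqVneq (T z).1 0.
  move: le; rewrite T0 normr0 normr_le0 => /eqP z0.
  by apply: (condP Wz Pz Dz ler01 (lexx 1));
    rewrite -surjective_pairing T0 scaler0.
have T1 : 0 < `|(T z).1| by rewrite normr_gt0.
apply: (@condP z.1 z.2 (`|z.1| / `|(T z).1|)) => //.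
- by rewrite ler_pdivrMr // mul1r.
- by rewrite -surjective_pairing mulrC -scalerA -e scalerA mulVf ?scale1r
  ?gt_eqF.
Qed.

Let ZmQ z : Zm z -> ~ Q z.1.
Proof.
case=> -[Wz Dz] /=; rewrite normr_le0 subr_eq0 => /eqP e Qz.
apply: (@condQ z.1 z.2 (`|z.1 - (T z).1| / `|h|)) => //.
rewrite -surjective_pairing mulrC -scalerA -e scalerA mulVf ?gt_eqF // scale1r.
by rewrite addrC subrK.
Qed.

Lemma homotopy_extension (r : R) : exists (F : X * Y -> X * Y) (L : set (X *
  Y)),
  [/\ forall z, (K `*` D) z -> (K `*` D) (F z),
      {within K `*` D, continuous F},
      compact L /\ forall z, (K `*` D) z -> L (F z),
      forall z, (K `*` D) z -> P z.1 -> (F z).1 = 0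
    & forall z, (K `*` D) z -> Q z.1 -> r < `|(F z).1| ] /\
  forall z, (K `*` D) z -> F z = z -> P z.1 \/ r < `|z.1|.
Proof.
(* Nothing is known of [T] outside [A]; a constant there keeps the images in the cone times [D] and
   in a compact set. *)
pose T' z := if `[< A z >] then T z else (0, y0).
have T'A z : A z -> T' z = T z by rewrite /T'; case: asboolP.
have T'KD z : (K `*` D) (T' z).
  rewrite /T'; case: asboolP => [Az|_]; first exact: TKD.
  split => //=.
  by rewrite -(scale0r h); apply: coneZ.
pose L0 := closure (T @` A) `|` [set (0, y0)].
have cL0 : compact L0.
  apply: compactU; last exact: compact_set1.
  by rewrite -precompactE.
have T'L z : L0 (T' z).
  rewrite /T'; case: asboolP => [Az|_]; last by right.
  by left; apply: subset_closure; exists z.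
have [c c0 cP] := bounded_setP (compact_bounded cL0).
have T'c z : `|T' z| <= c by apply: cP.
have T'1c z : `|(T' z).1| <= c.
  by apply: le_trans (T'c z); rewrite prod_normE /= le_max lexx.
(* This makes the norm of [M *: h] exceed that of every image of [T'] by more than [r]. *)
pose M := (`|r| + c + 1) / `|h|.
have M0 : 0 <= M by rewrite divr_ge0 // !addr_ge0.
have MhE : `|M *: h| = `|r| + c + 1.
  by rewrite normrZ ger0_norm // divfK // gt_eqF.
(* The level 1/2 of [p] splits the ring, so that the two homotopies do not interfere. *)
have [p [pc p01 pQ pP]] : exists u : X -> R, [/\ continuous u,
    forall x, 0 <= u x <= 1, forall x, Q x -> u x = 0 & forall x, P x -> u x =
      1].
  by apply: urysohn_separation_pm => //; rewrite setIC.
(* [l] fades the map out towards [P]. Being 1 on [Zl], it creates no fixed point; being 1 on the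
   half near [Q], it leaves that half to [s]. *)
have [l [lc l01 lP lZ]] : exists u : X * Y -> R, [/\ continuous u,
    forall z, 0 <= u z <= 1, forall z, (fst @^-1` P) z -> u z = 0 &
    forall z, (Zl `|` (p \o fst) @^-1` [set t | t <= 2^-1]) z -> u z = 1].
  apply: urysohn_separation_pm.
  - by apply: preimage_closed => // z _; exact: cvg_fst.
  - apply: closedU; first exact: closedZl.
    apply: preimage_closed; last exact: closed_le.
    by move=> z _; apply: continuous_comp; [exact: cvg_fst|exact: pc].
  - apply/seteqP; split=> // z [Pz [/ZlP//|]] /=.
    by rewrite pP //; lra.
have [s [sc s01 sZ sQ]] : exists u : X * Y -> R, [/\ continuous u,
    forall z, 0 <= u z <= 1,
    forall z, (Zm `|` (p \o fst) @^-1` [set t | 2^-1 <= t]) z -> u z = 0 &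
    forall z, (fst @^-1` Q) z -> u z = 1].
  apply: urysohn_separation_pm.
  - apply: closedU; first exact: closedZm.
    apply: preimage_closed; last exact: closed_ge.
    by move=> z _; apply: continuous_comp; [exact: cvg_fst|exact: pc].
  - by apply: preimage_closed => // z _; exact: cvg_fst.
  - apply/seteqP; split=> // z [[/ZmQ//|/=] + Qz].
    by rewrite pQ //; lra.
(* While [s] rises to 1/2, [m] pushes the map along [h]; beyond 1/2, [k] fades [T'] out under the
   full push, where a fixed point has norm above [r]. *)
pose m z := Num.min (2 * s z) 1.
pose k z := 1 - Num.max (2 * s z - 1) 0.
have m01 z : 0 <= m z <= 1.
  rewrite /m le_min ge_min lexx ler01 orbT !andbT mulr_ge0 //.
  by have /andP[] := s01 z.
have k01 z : 0 <= k z <= 1.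
  rewrite /k subr_ge0 gerBl ge_max le_max lexx ler01 orbT !andbT.
  by have /andP[_] := s01 z; lra.
pose a z := l z * k z.
have a01 z : 0 <= a z <= 1.
  have /andP[l0 l1] := l01 z; have /andP[k0 k1] := k01 z.
  by rewrite mulr_ge0 //= mulr_ile1.
have mc : continuous m.
  by move=> z; apply: cvg_minr; [apply: cvgMl_tmp; exact: sc|exact: cvg_cst].
have kc : continuous k.
  move=> z; apply: cvgB; first exact: cvg_cst.
  apply: cvg_maxr; last exact: cvg_cst.
  by apply: cvgB; [apply: cvgMl_tmp; exact: sc|exact: cvg_cst].
have ac : continuous a by move=> z; apply: cvgM; [exact: lc|exact: kc].
(* Factoring [F] through [G] on a compact parameter set shows that its image lies in a compact
   set. *)
pose G (q : R * R * (X * Y)) := q.1.1 *: q.2 + ((M * q.1.2) *: h, (1 - q.1.1)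
  *: y0).
pose F z := G ((a z, m z), T' z).
have F1 z : (F z).1 = a z *: (T' z).1 + (M * m z) *: h by [].
have F2 z : (F z).2 = a z *: (T' z).2 + (1 - a z) *: y0 by [].
have aP z : P z.1 -> a z = 0 by move=> Pz; rewrite /a lP ?mul0r.
have mP z : P z.1 -> m z = 0.
  move=> Pz; rewrite /m sZ ?mulr0; first by apply/min_idPl; rewrite ler01.
  by right; rewrite /= pP //; lra.
have aQ z : Q z.1 -> a z = 0.
  move=> Qz; rewrite /a /k sQ //; have -> : 2 * 1 - 1 = 1 :> R by ring.
  by rewrite max_l ?ler01 // subrr mulr0.
have mQ z : Q z.1 -> m z = 1 by move=> Qz; rewrite /m sQ // min_r //; lra.
have FQ z : Q z.1 -> r < `|(F z).1|.
  move=> Qz; rewrite F1 aQ // mQ // scale0r add0r mulr1 MhE.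
  by have := ler_norm r; lra.
exists F, (G @` ((`[0, 1] `*` `[0, 1]) `*` L0)); split; first split.
- move=> z _; have /andP[a0 a1] := a01 z; have [T1 T2] := T'KD z; split.
    rewrite F1; apply: coneD => //; apply: coneZ => //.
    by rewrite mulr_ge0 //; have /andP[] := m01 z.
  by rewrite F2; move/convex_setE: convexD; apply.
- apply/subspace_continuousP => z [Kz Dz].
  apply: (@cvgD _ _ _ _ _ (fun z => a z *: T' z)
    (fun z => ((M * m z) *: h, (1 - a z) *: y0))).
    apply: cvgZ_cutoff T'c _ _; first by apply: cvg_within_filter; exact: ac.
    (* [T'] may jump only on [P] and [Q], where [a] vanishes; elsewhere it agrees with [T]
       nearby. *)
    have [Pz|nP] := pselect (P z.1); first by left; exact: aP.
    have [Qz|nQ] := pselect (Q z.1); first by left; exact: aQ.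
    right.
    have nearA : \forall w \near within (K `*` D) (nbhs z), A w.
      have oPQ : open (fst @^-1` (~` (P `|` Q)) : set (X * Y)).
        by apply: open_comp => [w _|]; [exact: cvg_fst|apply: closed_openC;
          apply: closedU].
      rewrite near_withinE; have : nbhs z (fst @^-1` (~` (P `|` Q)) : set (X *
        Y)).
        by apply: open_nbhs_nbhs; split => // -[].
      by apply: filterS => w PQw [Kw Dw]; split => //; apply: subset_closure.
    have Az : A z by split => //; apply: subset_closure; split => // -[].
    have Tz : T @ within A (nbhs z) --> T z by apply: (subspace_continuousP _
      _).1.
    have TT' : {near within (K `*` D) (nbhs z), T =1 T'}.
      by apply: filterS nearA => w /T'A.
    rewrite (T'A z Az); apply: cvg_trans (near_eq_cvg TT') _.
    have : id @ within (K `*` D) (nbhs z) --> within A (nbhs z).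
      by apply: cvg_within_set => //; exact: cvg_within.
    by move=> idA; exact: (cvg_comp id T idA Tz).
  have mcw : M * m w @[w --> within (K `*` D) (nbhs z)] --> M * m z.
    by apply: cvgMl_tmp; apply: cvg_within_filter; exact: mc.
  have acw : 1 - a w @[w --> within (K `*` D) (nbhs z)] --> 1 - a z.
    by apply: cvgB; [exact: cvg_cst|apply: cvg_within_filter; exact: ac].
  exact: (cvg_pair (cvgZr_tmp mcw) (cvgZr_tmp acw)).
- split; last first.
    by move=> z _; exists ((a z, m z), T' z) => //=; rewrite !in_itv /= a01 m01.
  apply: continuous_compact; last first.
    by apply: compact_setX => //; apply: compact_setX; exact: segment_compact.
  apply: continuous_subspaceT => q.
  have q11 : w.1.1 @[w --> q] --> q.1.1 by apply: cvg_comp; exact: cvg_fst.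
  have q12 : w.1.2 @[w --> q] --> q.1.2.
    by apply: cvg_comp; [exact: cvg_fst|exact: cvg_snd].
  have q2 : w.2 @[w --> q] --> q.2 by exact: cvg_snd.
  apply: (@cvgD _ _ _ _ _ (fun w : R * R * (X * Y) => w.1.1 *: w.2)
    (fun w => ((M * w.1.2) *: h, (1 - w.1.1) *: y0))); first exact: cvgZ q11 q2.
  have q12M : M * w.1.2 @[w --> q] --> M * q.1.2 by apply: cvgMl_tmp.
  have q11B : 1 - w.1.1 @[w --> q] --> 1 - q.1.1.
    by apply: cvgB => //; exact: cvg_cst.
  exact: (cvg_pair (cvgZr_tmp q12M) (cvgZr_tmp q11B)).
- by move=> z _ Pz; rewrite F1 aP // mP // scale0r mulr0 scale0r addr0.
- by move=> z _; exact: FQ.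
move=> z [Kz Dz] Fz; have [Pz|nP] := pselect (P z.1); first by left.
right; have z1E : z.1 = a z *: (T' z).1 + (M * m z) *: h by rewrite -{1}Fz.
have [Qz|nQ] := pselect (Q z.1); first by rewrite -Fz; exact: FQ.
have /andP[a0 a1] := a01 z.
have Wz : W z.1 by split => // -[].
have Az : A z by split => //; apply: subset_closure.
rewrite (T'A z Az) in z1E.
have [s2|s2] := leP 2^-1 (s z).
  have mE : m z = 1 by rewrite /m min_r //; lra.
  have : `|M *: h| - `|a z *: (T z).1| <= `|z.1|.
    by rewrite z1E mE mulr1 [_ *: _ + _]addrC lerB_normD.
  have : `|a z *: (T z).1| <= c.
    rewrite normrZ ger0_norm // -[leRHS]mul1r; apply: ler_pM => //.
    by rewrite -(T'A z Az).
  by rewrite MhE; have := ler_norm r; lra.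
have kE : k z = 1 by rewrite /k max_r ?subr0 //; lra.
have aE : a z = l z by rewrite /a kE mulr1.
have Tfix : a z = 1 -> m z = 0 -> T z = z.
  move=> a1' m0; rewrite -[RHS]Fz [RHS]surjective_pairing F1 F2 (T'A z Az) a1'
    m0.
  by rewrite mulr0 subrr !scale0r !scale1r !addr0 -surjective_pairing.
exfalso; apply: (no_fixpoint Wz Dz).
(* Near [Q] the point lies in [Zm], near [P] in [Zl]; either way the cutoffs are trivial there and
   [T] itself fixes it. *)
have [p2|/ltW p2] := leP (p z.1) 2^-1.
  have lE : l z = 1 by apply: lZ; right.
  apply: Tfix; first by rewrite aE.
  rewrite /m sZ ?mulr0; first by apply/min_idPl; rewrite ler01.
  left; split=> //=.
  have -> : z.1 - (T z).1 = (M * m z) *: h.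
    by rewrite {1}z1E aE lE scale1r addrC addKr.
  by rewrite normrZ scalerA mulrC ger0_norm ?subrr ?normr0 // mulr_ge0 //;
    have /andP[] := m01 z.
have mE : m z = 0.
  rewrite /m sZ ?mulr0; first by apply/min_idPl; rewrite ler01.
  by right.
rewrite mE mulr0 scale0r addr0 in z1E.
apply: Tfix => //; rewrite aE; apply: lZ; left; split=> //=.
rewrite ge_max normr_le0 subr_eq0 subr_le0 {1 2 3}z1E normrZ ger0_norm //.
by rewrite !scalerA mulrC eqxx ler_piMl.
Qed.

End Homotopy.

(** * Compression and expansion *)

Section FixedPoints.
Variables (R : realType) (X Y : normedModType R).
Variables (K P Q : set X) (D : set Y) (T : X * Y -> X * Y) (h : X) (y0 : Y).
Hypothesis coneK : is_cone K.
Hypotheses (closedD : closed D) (convexD : convex_set D) (Dy0 : D y0).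
Hypotheses (closedP : closed P) (closedQ : closed Q) (PQ : P `&` Q = set0).
Let W : set X := K `\` (P `|` Q).
Let A : set (X * Y) := closure W `*` D.
Hypotheses (TKD : forall z, A z -> (K `*` D) (T z))
  (Tcont : {within A, continuous T}) (Tcomp : precompact (T @` A)).
Hypotheses (Kh : K h) (h0 : h <> 0).
Hypothesis (condP : forall x y l, closure W x -> P x -> D y ->
  0 <= l -> l <= 1 -> l *: (T (x, y)).1 <> x).
Hypothesis (condQ : forall x y m, closure W x -> Q x -> D y ->
  0 <= m -> (T (x, y)).1 + m *: h <> x).

Let closedK : closed K. Proof. by case: coneK. Qed.

Let K0 : K 0. Proof. by rewrite -(scale0r h); apply: coneZ. Qed.

Let KD0 : (K `*` D) !=set0. Proof. by exists (0, y0). Qed.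

Let closedKD : closed (K `*` D). Proof. exact: closed_setX. Qed.

Let convexKD : convex_set (K `*` D : set (X * Y)%type).
Proof.
case: coneK => _ /convex_setE cK _ _; move/convex_setE: convexD => cD.
apply/convex_setE => x y t [Kx Dx] [Ky Dy] t0 t1.
by split; [apply: cK|apply: cD].
Qed.

(** Otherwise Schauder's fixed point of the extension lies in [P], where the extension has first
    component 0, yet 0 is not in [P]. *)
Lemma compression_fixpoint (c : R) :
  ~ P 0 -> (forall x, K x -> ~ P x -> `|x| <= c) ->
  exists z, [/\ W z.1, D z.2 & T z = z].
Proof.
move=> P0 Pc; apply: contrapT => no_fix.
have [|F [L [[FKD Fc [cL FL] FP FQ] Ffix]]] :=
  @homotopy_extension _ _ _ K P Q D T h y0 coneK closedD convexD Dy0 closedP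
    closedQ
    PQ TKD Tcont Tcomp Kh h0 condP condQ _ c.
  by move=> z Wz Dz Tz; apply: no_fix; exists z.
have [z KDz Fz] := schauder convexKD closedKD KD0 FKD Fc cL FL.
have Pz : P z.1.
  have [//|] := Ffix z KDz Fz; rewrite ltNge => /negP zc.
  by apply: contrapT => /(Pc _ KDz.1).
by apply: P0; rewrite -(FP z KDz Pz) Fz.
Qed.

(* Rescaling the first component [n] of the image to [(t / |n|) ^+ 2 *: n] with
   [t = |x|] keeps the fixed points and exchanges [|n| > |x|] with [|n| < |x|],
   turning the expansive boundary behaviour into a compressive one. *)
Lemma expansion_fixpoint (p c : R) : 0 < p ->
  (forall x, K x -> `|x| <= p -> P x) ->
  (forall x, K x -> ~ Q x -> `|x| <= c) ->
  exists z, [/\ W z.1, D z.2 & T z = z].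
Proof.
move=> p0 pP Qc; apply: contrapT => no_fix.
pose q := Num.max p c.
have pq : p <= q by rewrite le_max lexx.
have q0 : 0 < q by apply: lt_le_trans p0 pq.
have Qq x : K x -> q < `|x| -> Q x.
  move=> Kx; rewrite gt_max => /andP[_ cx]; apply: contrapT => /(Qc _ Kx).
  by rewrite leNgt cx.
have [|F [L [[FKD Fc [cL FL] FP FQ] Ffix]]] :=
  @homotopy_extension _ _ _ K P Q D T h y0 coneK closedD convexD Dy0 closedP
    closedQ
    PQ TKD Tcont Tcomp Kh h0 condP condQ _ q.
  by move=> z Wz Dz Tz; apply: no_fix; exists z.
have h_gt0 : 0 < `|h| by rewrite normr_gt0; apply/eqP.
(* With this [d], any first component of norm below [d] still has norm below [p] after the
   correction by [h]. *)
pose d := p / (2 * (1 + `|h|)).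
have d0 : 0 < d by rewrite divr_gt0 // mulr_gt0 // ltr_pwDl.
have dh : d + d * `|h| < p.
  have -> : d + d * `|h| = p / 2 by rewrite /d; field;
    rewrite gt_eqF // ltr_pwDl.
  by lra.
have dp : d < p by apply: le_lt_trans dh; rewrite lerDl mulr_ge0 // ltW.
pose N (v : X * Y) : X := v.1 + Num.max (d - `|v.1|) 0 *: h.
have N_big v : d <= `|v.1| -> N v = v.1.
  by move=> dv; rewrite /N max_r ?scale0r ?addr0 // subr_le0.
have NK v : K v.1 -> K (N v).
  by move=> Kv; apply: coneD => //; apply: coneZ => //;
    rewrite le_max lexx orbT.
(* If the correction cancelled [v.1], a positive multiple of [h] and its opposite would both lie in
   the cone. *)
have N0 v : K v.1 -> N v != 0.
  move=> Kv; have [dv|vd] := leP d `|v.1|.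
    by rewrite N_big // -normr_gt0 (lt_le_trans d0 dv).
  have e0 : 0 < d - `|v.1| by rewrite subr_gt0.
  rewrite /N max_l ?(ltW e0) // addr_eq0; apply/negP => /eqP ve.
  have /eqP : (d - `|v.1|) *: h = 0.
    by apply: (coneNN coneK); [apply: coneZ => //; exact: ltW|rewrite -ve].
  by rewrite scaler_eq0 gt_eqF //=; apply/negP/eqP.
have Nc : continuous N.
  move=> v; have v1 : w.1 @[w --> v] --> v.1 by exact: cvg_fst.
  apply: (@cvgD _ _ _ _ _ fst (fun w => Num.max (d - `|w.1|) 0 *: h)) => //.
  apply: cvgZr_tmp; apply: cvg_maxr; last exact: cvg_cst.
  by apply: cvgB; [exact: cvg_cst|exact: cvg_norm v1].
pose Phi (w : R * (X * Y)) : X * Y := ((w.1 / `|N w.2|) ^+ 2 *: N w.2, w.2.2).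
have Phic w : K w.2.1 -> Phi @ w --> Phi w.
  move=> Kw; have w2 : v.2 @[v --> w] --> w.2 by exact: cvg_snd.
  have Nw : N v.2 @[v --> w] --> N w.2 by apply: cvg_comp w2 (Nc _).
  have w1 : v.1 @[v --> w] --> w.1 by exact: cvg_fst.
  have sw : v.1 / `|N v.2| @[v --> w] --> w.1 / `|N w.2|.
    apply: cvgM => //; apply: cvgV; first by rewrite normr_eq0 N0.
    exact: cvg_norm Nw.
  apply: cvg_pair; last by apply: cvg_comp w2 _; exact: cvg_snd.
  by apply: cvgZ => //; rewrite expr2; under eq_fun do rewrite expr2;
    apply: cvgM.
(* Clamping the norm to the interval from [p] to [q] keeps the rescaled images in a compact set. *)
pose t (z : X * Y) : R := Num.min (Num.max `|z.1| p) q.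
have tc : continuous t.
  move=> z; apply: cvg_minr; last exact: cvg_cst.
  by apply: cvg_maxr; [apply: cvg_norm; exact: cvg_fst|exact: cvg_cst].
have tpq z : p <= t z <= q.
  by rewrite /t le_min pq le_max lexx orbT /= ge_min lexx orbT.
pose G z := Phi (t z, F z).
have GKD z : (K `*` D) z -> (K `*` D) (G z).
  move=> /FKD[K1 D2]; split => //.
  exact: (coneZ coneK (NK (F z) K1) (sqr_ge0 _)).
have Gc : {within K `*` D, continuous G}.
  apply/subspace_continuousP => z KDz.
  have Fz := (subspace_continuousP _ _).1 Fc z KDz.
  have tz : t @ within (K `*` D) (nbhs z) --> t z.
    by apply: cvg_within_filter; exact: tc.
  exact: (cvg_comp _ _ (cvg_pair tz Fz) (Phic (t z, F z) (FKD z KDz).1)).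
have cLG : compact (Phi @` (`[p, q] `*` (L `&` (K `*` D)))).
  apply: continuous_compact; last first.
    by apply: compact_setX; [exact: segment_compact|exact: compact_closedI].
  apply/subspace_continuousP => w [_ [_ [Kw _]]].
  by apply: cvg_within_filter; exact: Phic.
have GL z : (K `*` D) z -> (Phi @` (`[p, q] `*` (L `&` (K `*` D)))) (G z).
  move=> KDz; exists (t z, F z) => //; split; first by rewrite /= in_itv /= tpq.
  by split; [exact: FL|exact: FKD].
have [z KDz Gz] := schauder convexKD closedKD KD0 GKD Gc cLG GL.
have [Kz Dz] := KDz; have [KF DF] := FKD z KDz.
set n := N (F z).
have z1E : z.1 = (t z / `|n|) ^+ 2 *: n by rewrite -{1}Gz.
have n_gt0 : 0 < `|n| by rewrite normr_gt0 N0.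
(* At norm at most [p] the left side is below [p ^+ 2], and above [q] it exceeds [q ^+ 2]; in
   between it forces equal norms, so the rescaling is trivial. *)
have zn : `|z.1| * `|n| = t z ^+ 2.
  rewrite {1}z1E normrZ ger0_norm ?sqr_ge0 // expr_div_n.
  by field; rewrite gt_eqF.
have [zp|pz] := leP `|z.1| p.
  have tz : t z = p by rewrite /t max_r // min_l.
  have nE : n = d *: h.
    by rewrite /n /N (FP z KDz (pP _ Kz zp)) normr0 subr0 add0r max_l // ltW.
  have : `|n| < p.
    rewrite nE normrZ gtr0_norm //; apply: le_lt_trans dh.
    by rewrite lerDr ltW.
  by move=> np; rewrite tz expr2 in zn; nra.
have [zq|qz] := leP `|z.1| q; last first.
  have tz : t z = q by rewrite /t max_l ?min_r // ?(ltW qz) // (le_trans pq) //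
    ltW.
  have qF := FQ z KDz (Qq _ Kz qz).
  have nE : n = (F z).1 by rewrite /n N_big //; lra.
  by rewrite tz expr2 nE in zn; nra.
have tz : t z = `|z.1| by rewrite /t max_l ?min_l // ltW.
have nz : `|n| = `|z.1|.
  by rewrite tz expr2 in zn; apply: (mulfI _ zn);
    rewrite gt_eqF // (lt_trans p0).
have z1n : z.1 = n.
  by rewrite z1E tz nz divff ?expr1n ?scale1r // gt_eqF // (lt_trans p0).
have [dF|Fd] := leP d `|(F z).1|; last first.
  have : `|n| <= `|(F z).1| + (d - `|(F z).1|) * `|h|.
    rewrite /n /N max_l ?subr_ge0 ?(ltW Fd) //.
    apply: le_trans (ler_normD _ _) _.
    by rewrite normrZ [`|d - _|]ger0_norm // subr_ge0 ltW.
  by have := normr_ge0 (F z).1; nra.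
have Fz : F z = z.
  rewrite [LHS]surjective_pairing [RHS]surjective_pairing; congr (_, _).
    by rewrite z1n /n N_big.
  by rewrite -{2}Gz.
have [Pz|] := Ffix z KDz Fz; last by rewrite ltNge zq.
by move: dF; rewrite (FP z KDz Pz) normr0 leNgt d0.
Qed.

End FixedPoints.

(** * Relative topology and rings of the cone *)

Lemma rel_closureE (S : topologicalType) (K A : set S) :
  closed K -> A `<=` K -> rel_closure K A = closure A.
Proof.
move=> cK AK; rewrite /rel_closure closure_subspaceW //; apply/setIidl.
by rewrite [X in _ `<=` X](closure_id K).1 //; exact: closureS.
Qed.

Lemma closed_rel_compl (S : topologicalType) (K A : set S) :
  closed K -> rel_open K A -> closed (K `\` A).
Proof. by move=> cK [_ oA]; rewrite closed_setSI //; exact: open_closedC. Qed.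

Lemma rel_open_nbhs (S : topologicalType) (K A : set S) (x : S) :
  rel_open K A -> A x -> \forall y \near x, K y -> A y.
Proof.
move=> [AK /open_subspaceP[G openG GKA]] Ax.
have [Gx _] : (G `&` K) x by rewrite GKA; split => //; exact: AK.
have := open_nbhs_nbhs (conj openG Gx); apply: filterS => y Gy Ky.
by have [] : (A `&` K) y by rewrite -GKA.
Qed.

Lemma compact_mapS (S1 S2 : topologicalType) (A A' : set S1) (B : set S2)
    (f : S1 -> S2) : A' `<=` A -> compact_map A B f -> compact_map A' B f.
Proof.
move=> A'A [fAB fc pc]; split; first by move=> x /A'A; exact: fAB.
  exact: continuous_subspaceW fc.
by apply: precompact_subset pc; exact: image_subset.
Qed.

Section Rings.
Variables (R : realType) (X Y : normedModType R).
Variables (K V U : set X) (D : set Y) (T : X * Y -> X * Y) (h : X).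
Hypothesis coneK : is_cone K.
Hypotheses (openI : rel_open K V) (openO : rel_open K U).
Hypotheses (clIO : rel_closure K V `<=` U) (bndO : bounded_set U) (I0 : V 0).
Hypotheses (D0 : D !=set0) (closedD : closed D) (convexD : convex_set D).
Hypothesis compactT :
  compact_map ((rel_closure K U `\` V) `*` D) (K `*` D) T.
Hypotheses (Kh : K h) (h0 : h <> 0).

Let closedK : closed K. Proof. by case: coneK. Qed.

Let clI : rel_closure K V = closure V.
Proof. by apply: rel_closureE => //; case: openI. Qed.

Let clO : rel_closure K U = closure U.
Proof. by apply: rel_closureE => //; case: openO. Qed.

Let U0 : U 0.
Proof. by apply: clIO; rewrite clI; exact: subset_closure. Qed.

Let ringE : K `\` (K `\` U `|` closure V) = U `\` closure V.
Proof.
apply/seteqP; split=> x [].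
  move=> Kx /not_orP[nO nI]; split => //; apply: contrapT => Ox.
  by apply: nO.
move=> Ox nI; split; first by case: openO => + _; apply.
by move=> [[]|].
Qed.

Let disjointIO : (K `\` U) `&` closure V = set0.
Proof.
by apply/seteqP; split=> // x [[_ nO]]; rewrite -clI => /clIO.
Qed.

(** Near a point of [V] the cone lies in [V], hence misses the ring. *)
Let closure_ring : closure (U `\` closure V) `<=` closure U `\` V.
Proof.
move=> x xW; split; first by apply: closureS xW => y [].
move=> Ix; have [y [[Oy nIy] Ky]] := xW _ (rel_open_nbhs openI Ix).
by apply: nIy; apply: subset_closure; apply: Ky; case: openO => + _; apply.
Qed.

Let compactW : compact_map (closure (U `\` closure V) `*` D) (K `*` D) T.
Proof.
apply: compact_mapS compactT => z [/closure_ring + Dz].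
by rewrite clO; split.
Qed.

(** Here (ii) holds on the outer boundary, so [P] is the complement of [U] in [K] and [Q] the
    closure of [V]. *)
Lemma ring_compression :
  (forall u m, rel_boundary K V u.1 -> D u.2 -> 0 <= m ->
     (T u).1 + m *: h <> u.1) ->
  (forall u l, rel_boundary K U u.1 -> D u.2 -> 1 <= l ->
     (T u).1 <> l *: u.1) ->
  exists z, [/\ (U `\` rel_closure K V) z.1, D z.2 & T z = z].
Proof.
move=> condI condO; have [y0 Dy0] := D0; have [c _ cP] := bounded_setP bndO.
have [TKD Tc Tp] := compactW; rewrite -ringE in TKD Tc Tp.
suff [z [Wz Dz Tz]] : exists z,
    [/\ (K `\` (K `\` U `|` closure V)) z.1, D z.2 & T z = z].
  by exists z; split=> //; move: Wz; rewrite ringE clI.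
apply: (@compression_fixpoint _ _ _ K (K `\` U) (closure V) D T h y0 _ _ _ _ _
  _ _
  TKD Tc Tp _ _ _ _ c) => //.
- exact: closed_rel_compl.
- exact: closed_closure.
- move=> x y l; rewrite ringE => /closure_ring[clOx nIx] [Kx nOx] Dy l0 l1 lx.
  have bOx : rel_boundary K U x.
    by split; [rewrite clO|move/interior_subset].
  move: l0; rewrite le_eqVlt => /orP[/eqP l0|l0].
    by apply: nOx; rewrite -lx -l0 scale0r.
  apply: (condO (x, y) l^-1) => //=; first by rewrite invf_ge1.
  by rewrite -[in RHS]lx scalerA mulVf ?scale1r // gt_eqF.
- move=> x y m; rewrite ringE => /closure_ring[clOx nIx] clIx Dy m0.
  by apply: (condI (x, y)) => //; split; [rewrite clI|move/interior_subset].
- by case.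
- by move=> x Kx nP; apply: cP; apply: contrapT => nO; apply: nP.
Qed.

(** The roles of [P] and [Q] are exchanged; a ball around 0 inside [V] supplies the radius for the
    rescaling. *)
Lemma ring_expansion :
  (forall u m, rel_boundary K U u.1 -> D u.2 -> 0 <= m ->
     (T u).1 + m *: h <> u.1) ->
  (forall u l, rel_boundary K V u.1 -> D u.2 -> 1 <= l ->
     (T u).1 <> l *: u.1) ->
  exists z, [/\ (U `\` rel_closure K V) z.1, D z.2 & T z = z].
Proof.
move=> condO condI; have [y0 Dy0] := D0; have [c _ cP] := bounded_setP bndO.
have /nbhs_ballP[p /= p0 pI] := rel_open_nbhs openI I0.
have [TKD Tc Tp] := compactW; rewrite -ringE setUC in TKD Tc Tp.
suff [z [Wz Dz Tz]] : exists z,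
    [/\ (K `\` (closure V `|` K `\` U)) z.1, D z.2 & T z = z].
  by exists z; split=> //; move: Wz; rewrite setUC ringE clI.
apply: (@expansion_fixpoint _ _ _ K (closure V) (K `\` U) D T h y0 _ _ _ _ _ _ _
  TKD Tc Tp _ _ _ _ (p / 2) c) => //.
- exact: closed_closure.
- exact: closed_rel_compl.
- by rewrite setIC.
- move=> x y l; rewrite setUC ringE => /closure_ring[clOx nIx] clIx Dy l0 l1 lx.
  have bIx : rel_boundary K V x.
    by split; [rewrite clI|move/interior_subset].
  move: l0; rewrite le_eqVlt => /orP[/eqP l0|l0].
    by apply: nIx; rewrite -lx -l0 scale0r.
  apply: (condI (x, y) l^-1) => //=; first by rewrite invf_ge1.
  by rewrite -[in RHS]lx scalerA mulVf ?scale1r // gt_eqF.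
- move=> x y m; rewrite setUC ringE => /closure_ring[clOx nIx] [Kx nOx] Dy m0.
  by apply: (condO (x, y)) => //; split; [rewrite clO|move/interior_subset].
- by rewrite divr_gt0.
(* Halving the radius turns the non-strict bound into membership in the open ball. *)
- move=> x Kx xp; apply: subset_closure; apply: pI => //.
  by rewrite -ball_normE /= sub0r normrN; lra.
- by move=> x Kx nQ; apply: cP; apply: contrapT => nO; apply: nQ.
Qed.

End Rings.

Theorem theorem2p5 (R : realType) (X Y : completeNormedModType R)
    (K1 U1 U2 V1 V2 : set X) (D : set Y) (T : X * Y -> X * Y)
    (coneK1 : is_cone K1)
    (bndU1 : bounded_set U1) (bndU2 : bounded_set U2)
    (bndV1 : bounded_set V1) (bndV2 : bounded_set V2)
    (openU1 : rel_open K1 U1) (openU2 : rel_open K1 U2)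
    (openV1 : rel_open K1 V1) (openV2 : rel_open K1 V2)
    (V1_0 : V1 0)
    (clV1U1 : rel_closure K1 V1 `<=` U1)
    (clV2U2 : rel_closure K1 V2 `<=` U2)
    (clU1V2 : rel_closure K1 U1 `<=` V2)
    (D0 : D !=set0) (closedD : closed D) (convexD : convex_set D)
    (compactT :
      compact_map ((rel_closure K1 U2 `\` V1) `*` D) (K1 `*` D) T)
    (cond1 : boundary_conditions K1 U1 V1 D (fun u => (T u).1))
    (cond2 : boundary_conditions K1 U2 V2 D (fun u => (T u).1)) :
  exists u v w : X * Y,
    [/\ [/\ (K1 `*` D) u, (K1 `*` D) v & (K1 `*` D) w],
        [/\ T u = u, T v = v & T w = w],
        [/\ u <> v, u <> w & v <> w]
      & [/\ (U1 `\` rel_closure K1 V1) u.1,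
            (U2 `\` rel_closure K1 V2) v.1
          & (V2 `\` rel_closure K1 U1) w.1]].
Proof.
have subcl A : A `<=` rel_closure K1 A := @subset_closure (subspace K1) A.
have clS A B : A `<=` B -> rel_closure K1 A `<=` rel_closure K1 B :=
  @closureS (subspace K1) A B.
have V1U1 : V1 `<=` U1 by apply: subset_trans clV1U1.
have U1V2 : U1 `<=` V2 by apply: subset_trans clU1V2.
have V2U2 : V2 `<=` U2 by apply: subset_trans clV2U2.
have compactTS I O : O `<=` U2 -> V1 `<=` I ->
    compact_map ((rel_closure K1 O `\` I) `*` D) (K1 `*` D) T.
  move=> OU2 V1I; apply: compact_mapS compactT => z [[/(clS _ _ OU2) clz nI]
    Dz].
  by split => //; split => // /V1I.
have [h1 [Kh1 h10 expV1 comU1]] := cond1.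
have [h2 [Kh2 h20 expV2 comU2]] := cond2.
have V2_0 : V2 0 by apply/U1V2/V1U1.
have U1_0 : U1 0 by apply: V1U1.
have [u [[Uu Vu] Du Tu]] : exists z, [/\ (U1 `\` rel_closure K1 V1) z.1, D z.2
  & T z = z].
  apply: (ring_compression (h := h1)) => //.
  by apply: compactTS => //; apply: subset_trans V2U2.
have [v [[Uv Vv] Dv Tv]] : exists z, [/\ (U2 `\` rel_closure K1 V2) z.1, D z.2
  & T z = z].
  apply: (ring_compression (h := h2)) => //.
  by apply: compactTS => //; apply: subset_trans U1V2.
(* This ring takes (ii) on its inner boundary from index 1 and (i) on its outer boundary from index
   2, hence [h2]. *)
have [w [[Vw Uw] Dw Tw]] : exists z, [/\ (V2 `\` rel_closure K1 U1) z.1, D z.2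
  & T z = z].
  by apply: (ring_expansion (h := h2)) => //; apply: compactTS.
exists u, v, w; split; split=> //.
- by split => //; apply: openU1.1.
- by split => //; apply: openU2.1.
- by split => //; apply: openV2.1.
(* The three rings are disjoint because the sets are nested. *)
- by move=> uv; apply: Vv; rewrite -uv; apply/subcl/U1V2.
- by move=> uw; apply: Uw; rewrite -uw; apply: subcl.
- by move=> vw; apply: Vv; rewrite vw; apply: subcl.
Qed.
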